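(* Let $p:\mathbb{E}\to\mathbb{B}$ be a fibred type-theoretic fibration category with a fibred universe $w:\tilde W\to W$ above $u:\tilde U\to U$, $\mathbb{A}$ a type-theoretic fibration category with a universe $v:\tilde V\to V$, and $F:\mathbb{A}\to\mathbb{B}$ a functor preserving fibrations, pullbacks of fibrations and acyclic cofibrations. Suppose $Fv$ is a pullback of $u$ along a morphism $h:FV\to U$ with upper morphism $k:F\tilde V\to\tilde U$. Then $(v,h^*w):(\tilde V,k^*\tilde W)\to(V,h^*W)$ is a fibred universe in $F^*\mathbb{E}$, where $h^*w:k^*\tilde W\to h^*W$ is the morphism above $Fv$ induced by $w$ (the pullback of $w$ along the cartesian morphism $h^*W\to W$).
   Context: A morphism $i:A\to B$ has the left lifting property with respect to $q:C\to D$ if for all $f:A\to C$, $g:B\to D$ with $qf=gi$ there is $h:B\to C$ with $hi=f$ and $qh=g$. A type-theoretic fibration category is a category $\mathbb{C}$ with a terminal object $1$ and a subcategory whose morphisms are called fibrations, such that (an acyclic cofibration being a morphism with the left lifting property with respect to all fibrations): (i) all isomorphisms and all morphisms with codomain $1$ are fibrations; (ii) pullbacks of fibrations along arbitrary morphisms exist and are fibrations; (iii) every morphism factors as an acyclic cofibration followed by a fibration; (iv) for any fibrations $f:A\to B$ and $g:B\to C$ there is a fibration $\Pi_gf:\Pi_gA\to C$, called a dependent product of $f$ along $g$, with a natural bijection $(\mathbb{C}/C)(h,\Pi_gf)\cong(\mathbb{C}/B)(g^*h,f)$ for all $h:X\to C$. A type-theoretic functor preserves terminal objects, fibrations, pullbacks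 of fibrations, acyclic cofibrations and dependent products. A fibred category is a Grothendieck fibration; $f$ is above $s$ if $pf=s$. A fibred type-theoretic fibration category is a fibred category $p:\mathbb{E}\to\mathbb{B}$ such that: (1) $\mathbb{E}$ and $\mathbb{B}$ are type-theoretic fibration categories and $p$ is a type-theoretic functor; (2) every cartesian morphism above a fibration is a fibration; (3) if $g:A\to C$ is a fibration in $\mathbb{E}$, $pg=t\circ s$ with $s:pA\to J$ a fibration and $t:J\to pC$, then the induced morphism $A\to t^*C$ above $s$ is a fibration; (4) every cartesian morphism above an acyclic cofibration is an acyclic cofibration. The change of base $F^*\mathbb{E}\to\mathbb{A}$ has as objects of $F^*\mathbb{E}$ pairs $(I,A)$ with $I\in\mathbb{A}$, $A\in\mathbb{E}$, $pA=FI$, and as morphisms $(I,A)\to(J,B)$ pairs $(s,f)$ with $s:I\to J$ in $\mathbb{A}$ and $f:A\to B$ above $Fs$. For $F$ as in the claim it is a fibred type-theoretic fibration category in which $(s,f)$ is a fibration iff $s$ and $f$ are fibrations. A fibration $u:\tilde U\to U$ in a type-theoretic fibration category is a universe if, calling pullbacks of $u$ ($u$-)small fibrations: (a) small fibrations are closed under composition and contain the identities; (b) if $f:A\to B$ and $g:B\to C$ are small fibrations, so is $\Pi_gf:\Pi_gA\to C$; (c) if $A\to C$ and $B\to C$ are small fibrations, any morphism $A\to B$ over $C$ factors as an acyclic cofibration followed by a small fibration. A fibred universe in a fibred type-theoretic fibration category $p:\mathbb{E}\to\mathbb{B}$ is a fibration $w:\tilde W\to W$ in $\mathbb{E}$ such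 that: (1) $w$ and $pw$ are universes in $\mathbb{E}$ and $\mathbb{B}$ respectively; (2) for a $w$-small fibration $f:A\to B$ and a pullback square exhibiting $pf$ as a pullback of $pw$ along $h:pB\to pW$ with upper morphism $k:pA\to p\tilde W$, there is a pullback square exhibiting $f$ as a pullback of $w$ along some $\bar h:B\to W$ above $h$ with upper morphism $\bar k:A\to\tilde W$ above $k$; (3) every cartesian morphism above a $pw$-small fibration is a $w$-small fibration; (4) for every $w$-small fibration $g:A\to C$, $pw$-small fibration $s:pA\to J$ and arbitrary morphism $t:J\to pC$ with $t\circ s=pg$, the induced morphism $A\to t^*C$ (above $s$) is a $w$-small fibration. That $w$ is above $u$ means $pw=u$. *)

(* Defs.v *)
From Stdlib Require Import ProofIrrelevance.

Set Implicit Arguments.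
Unset Strict Implicit.
Unset Printing Implicit Defensive.

(** * Categories and functors *)

Record category := Category {
  Ob :> Type;
  Hom : Ob -> Ob -> Type;
  idm : forall a, Hom a a;
  comp : forall a b c, Hom b c -> Hom a b -> Hom a c;
  comp_assoc : forall a b c d (h : Hom c d) (g : Hom b c) (f : Hom a b),
    comp h (comp g f) = comp (comp h g) f;
  comp_idl : forall a b (f : Hom a b), comp (idm b) f = f;
  comp_idr : forall a b (f : Hom a b), comp f (idm a) = f
}.

Arguments Hom {C} a b : rename.
Arguments idm {C} a : rename.
Arguments comp {C a b c} g f : rename.

Declare Scope cat_scope.
Delimit Scope cat_scope with cat.
Open Scope cat_scope.
Notation "g ∘ f" := (comp g f) (at level 40, left associativity) : cat_scope.

Record functor (C D : category) := Functor {
  fobj :> Ob C -> Ob D;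
  fmap : forall a b : C, Hom a b -> Hom (fobj a) (fobj b);
  fmap_id : forall a : C, fmap (idm a) = idm (fobj a);
  fmap_comp : forall (a b c : C) (g : Hom b c) (f : Hom a b),
    fmap (g ∘ f) = fmap g ∘ fmap f
}.

Arguments fmap {C D} f {a b} _ : rename.

Section CategoryNotions.
Variable C : category.

Definition is_iso (a b : C) (f : Hom a b) : Prop :=
  exists g : Hom b a, g ∘ f = idm a /\ f ∘ g = idm b.

Definition is_terminal (t : C) : Prop :=
  forall a : C, exists! f : Hom a t, True.

Definition has_llp (a b c d : C) (i : Hom a b) (q : Hom c d) : Prop :=
  forall (f : Hom a c) (g : Hom b d), q ∘ f = g ∘ i ->
  exists h : Hom b c, h ∘ i = f /\ q ∘ h = g.

(** The square
<<
      a --k--> c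
      |        |
      f        q
      v        v
      b --h--> d
>>
    exhibits [f] as a pullback of [q] along [h] with upper morphism [k]. *)
Definition is_pullback (a b c d : C)
    (k : Hom a c) (f : Hom a b) (q : Hom c d) (h : Hom b d) : Prop :=
  q ∘ k = h ∘ f /\
  forall (x : C) (y : Hom x c) (z : Hom x b), q ∘ y = h ∘ z ->
  exists! m : Hom x a, k ∘ m = y /\ f ∘ m = z.

(** Morphisms from [f] to [g] in the slice over [c]. *)
Definition over (c x y : C) (f : Hom x c) (g : Hom y c) : Type :=
  { k : Hom x y | g ∘ k = f }.

Lemma over_comp_proof (c x y z : C) (f : Hom x c) (g : Hom y c) (h : Hom z c)
    (l : over g h) (k : over f g) : h ∘ (proj1_sig l ∘ proj1_sig k) = f.
Proof. now rewrite comp_assoc, (proj2_sig l), (proj2_sig k). Qed.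

Definition over_comp (c x y z : C) (f : Hom x c) (g : Hom y c) (h : Hom z c)
    (l : over g h) (k : over f g) : over f h :=
  exist _ (proj1_sig l ∘ proj1_sig k) (over_comp_proof l k).

(** [dep_prod f g pf] is a bijection (C/c)(h, pf) ≅ (C/b)(g^*h, f), natural in
    [h : Hom x c].  No choice of pullbacks is made: the bijection is given for
    every pullback [q : z -> b] of [h] along [g], and naturality is required
    for every morphism [s] over [c] and the morphism [y] it induces between
    the given pullbacks, i.e. [y = g^*s]. *)
Record dep_prod (a b c pa : C)
    (f : Hom a b) (g : Hom b c) (pf : Hom pa c) : Type := DepProd {
  transpose : forall (x z : C) (h : Hom x c) (q : Hom z b) (r : Hom z x),
    is_pullback q r g h -> over h pf -> over q f;
  transpose_bij : forall (x z : C) (h : Hom x c) (q : Hom z b) (r : Hom z x)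
    (pb : is_pullback q r g h) (m : over q f),
    exists! k : over h pf, transpose pb k = m;
  transpose_nat : forall (x z : C) (h : Hom x c) (q : Hom z b) (r : Hom z x)
    (pb : is_pullback q r g h)
    (x' z' : C) (h' : Hom x' c) (q' : Hom z' b) (r' : Hom z' x')
    (pb' : is_pullback q' r' g h')
    (s : over h' h) (y : over q' q),
    r ∘ proj1_sig y = proj1_sig s ∘ r' ->
    forall k : over h pf,
    transpose pb' (over_comp k s) = over_comp (transpose pb k) y
}.

End CategoryNotions.

Lemma fmap_over_proof (C D : category) (F : functor C D) (c x y : C)
    (f : Hom x c) (g : Hom y c) (k : over f g) :
  fmap F g ∘ fmap F (proj1_sig k) = fmap F f.
Proof. now rewrite <- fmap_comp, (proj2_sig k). Qed.

Definition fmap_over (C D : category) (F : functor C D) (c x y : C)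
    (f : Hom x c) (g : Hom y c) (k : over f g) : over (fmap F f) (fmap F g) :=
  exist _ (fmap F (proj1_sig k)) (fmap_over_proof F k).

(** * Type-theoretic fibration categories *)

(** A category with a class of morphisms called fibrations; the axioms are in
    [is_ttfc]. *)
Record fib_category := FibCategory {
  fc_cat :> category;
  is_fib : forall a b : fc_cat, Hom a b -> Prop
}.

Arguments is_fib {f a b} _ : rename.

Section TTFC.
Variable C : fib_category.

Definition is_acof (a b : C) (i : Hom a b) : Prop :=
  forall (c d : C) (q : Hom c d), is_fib q -> has_llp i q.

Definition is_dep_prod (a b c pa : C)
    (f : Hom a b) (g : Hom b c) (pf : Hom pa c) : Prop :=
  is_fib pf /\ inhabited (dep_prod f g pf).

Record is_ttfc : Prop := {
  ttfc_terminal : exists t : C, is_terminal t;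
  ttfc_fib_comp : forall (a b c : C) (g : Hom b c) (f : Hom a b),
    is_fib g -> is_fib f -> is_fib (g ∘ f);
  ttfc_fib_iso : forall (a b : C) (f : Hom a b), is_iso f -> is_fib f;
  ttfc_fib_terminal : forall (a t : C) (f : Hom a t),
    is_terminal t -> is_fib f;
  ttfc_pullback : forall (b c d : C) (q : Hom c d) (h : Hom b d),
    is_fib q -> exists (a : C) (k : Hom a c) (f : Hom a b),
    is_pullback k f q h;
  ttfc_fib_pullback : forall (a b c d : C)
    (k : Hom a c) (f : Hom a b) (q : Hom c d) (h : Hom b d),
    is_pullback k f q h -> is_fib q -> is_fib f;
  ttfc_factor : forall (a b : C) (f : Hom a b),
    exists (m : C) (i : Hom a m) (q : Hom m b),
    is_acof i /\ is_fib q /\ q ∘ i = f;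
  ttfc_dep_prod : forall (a b c : C) (f : Hom a b) (g : Hom b c),
    is_fib f -> is_fib g ->
    exists (pa : C) (pf : Hom pa c), is_dep_prod f g pf
}.

(** [is_small u f]: [f] is a [u]-small fibration. *)
Definition is_small (u1 u0 : C) (u : Hom u1 u0) (a b : C) (f : Hom a b) : Prop :=
  exists (h : Hom b u0) (k : Hom a u1), is_pullback k f u h.

Record is_universe (u1 u0 : C) (u : Hom u1 u0) : Prop := {
  universe_fib : is_fib u;
  universe_comp : forall (a b c : C) (g : Hom b c) (f : Hom a b),
    is_small u g -> is_small u f -> is_small u (g ∘ f);
  universe_id : forall a : C, is_small u (idm a);
  universe_dep_prod : forall (a b c pa : C)
    (f : Hom a b) (g : Hom b c) (pf : Hom pa c),
    is_small u f -> is_small u g -> is_dep_prod f g pf -> is_small u pf;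
  universe_factor : forall (a b c : C) (f : Hom a c) (g : Hom b c) (m : Hom a b),
    is_small u f -> is_small u g -> g ∘ m = f ->
    exists (n : C) (i : Hom a n) (q : Hom n b),
    is_acof i /\ is_small u q /\ q ∘ i = m
}.

End TTFC.

(** * Type-theoretic functors *)

Section Functors.
Variables (C D : fib_category) (F : functor C D).

Definition preserves_terminal : Prop :=
  forall t : C, is_terminal t -> is_terminal (F t).

Definition preserves_fib : Prop :=
  forall (a b : C) (f : Hom a b), is_fib f -> is_fib (fmap F f).

Definition preserves_fib_pullback : Prop :=
  forall (a b c d : C)
    (k : Hom a c) (f : Hom a b) (q : Hom c d) (h : Hom b d),
  is_fib q -> is_pullback k f q h ->
  is_pullback (fmap F k) (fmap F f) (fmap F q) (fmap F h).

Definition preserves_acof : Prop :=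
  forall (a b : C) (i : Hom a b), is_acof i -> is_acof (fmap F i).

(** The image of a dependent product is a dependent product whose bijection
    extends the action of [F] on the given one; equivalently, [F] preserves the
    universal morphism, so that the canonical comparison with any other
    dependent product of the images is invertible. *)
Definition preserves_dep_prod : Prop :=
  forall (a b c pa : C) (f : Hom a b) (g : Hom b c) (pf : Hom pa c),
  is_fib f -> is_fib g -> is_fib pf -> forall P : dep_prod f g pf,
  exists Q : dep_prod (fmap F f) (fmap F g) (fmap F pf),
  forall (x z : C) (h : Hom x c) (q : Hom z b) (r : Hom z x)
    (pb : is_pullback q r g h)
    (Fpb : is_pullback (fmap F q) (fmap F r) (fmap F g) (fmap F h))
    (k : over h pf),
  transpose Q Fpb (fmap_over F k) = fmap_over F (transpose P pb k).

Record is_tt_functor : Prop := {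
  ttf_terminal : preserves_terminal;
  ttf_fib : preserves_fib;
  ttf_fib_pullback : preserves_fib_pullback;
  ttf_acof : preserves_acof;
  ttf_dep_prod : preserves_dep_prod
}.

End Functors.

(** * Fibred categories *)

Section FibredNotions.
Variables (E B : category) (p : functor E B).

(** [above f s] is the equation [p f = s] between morphisms of [B] whose
    domains and codomains are only propositionally equal: [s] has domain and
    codomain equal to those of [p f], and is equal to [p f] along these
    equalities. *)
Inductive above (a a' : E) (f : Hom a a') : forall i i' : B, Hom i i' -> Prop :=
  Above : above f (fmap p f).

Definition is_cartesian (a b : E) (f : Hom a b) : Prop :=
  forall (c : E) (g : Hom c b) (s : Hom (p c) (p a)),
  fmap p f ∘ s = fmap p g ->
  exists! h : Hom c a, f ∘ h = g /\ fmap p h = s.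

Definition is_fibred_category : Prop :=
  forall (b : E) (i : B) (s : Hom i (p b)),
  exists (a : E) (f : Hom a b), is_cartesian f /\ above f s.

Lemma above_dom (a a' : E) (f : Hom a a') (i i' : B) (s : Hom i i') :
  above f s -> p a = i.
Proof. now intros []. Qed.

Lemma above_id (a : E) (i : B) : p a = i -> above (idm a) (idm i).
Proof. intros <-. rewrite <- fmap_id. apply Above. Qed.

(** [castHom] transports a morphism along equalities of objects. *)
Definition castHom (i j i' j' : B) (e : i = i') (e' : j = j')
    (s : Hom i j) : Hom i' j' :=
  eq_rect j (fun y => Hom i' y) (eq_rect i (fun x => Hom x j) s i' e) j' e'.

Lemma aboveE (a a' : E) (f : Hom a a') (i i' : B) (s : Hom i i') :
  above f s <-> exists (e : p a = i) (e' : p a' = i'), castHom e e' (fmap p f) = s.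
Proof.
split.
- intros []. now exists eq_refl, eq_refl.
- intros [e [e' <-]]. destruct e, e'. apply Above.
Qed.

Lemma above_comp (a b c : E) (g : Hom b c) (f : Hom a b)
    (i j k : B) (t : Hom j k) (s : Hom i j) :
  above g t -> above f s -> above (g ∘ f) (t ∘ s).
Proof.
intros Hg Hf. revert t Hg. destruct Hf. intros t Hg.
apply aboveE in Hg. destruct Hg as [e [e' <-]].
rewrite (proof_irrelevance _ e eq_refl). destruct e'. simpl.
rewrite <- fmap_comp. apply Above.
Qed.

End FibredNotions.

(** * Fibred type-theoretic fibration categories and fibred universes *)

Section Fibred.
Variables (E B : fib_category) (p : functor E B).

(** In [fttfc_induced] and [funiverse_induced], [l : t^*c -> c] is any
    cartesian morphism above [t], and [m] is the morphism above [s] that it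
    induces. *)
Record is_fibred_ttfc : Prop := {
  fttfc_fibred : is_fibred_category p;
  fttfc_total : is_ttfc E;
  fttfc_base : is_ttfc B;
  fttfc_functor : is_tt_functor p;
  fttfc_cartesian_fib : forall (a b : E) (f : Hom a b),
    is_cartesian p f -> is_fib (fmap p f) -> is_fib f;
  fttfc_induced : forall (a c : E) (g : Hom a c)
    (j : B) (s : Hom (p a) j) (t : Hom j (p c)),
    is_fib g -> fmap p g = t ∘ s -> is_fib s ->
    forall (tc : E) (l : Hom tc c) (m : Hom a tc),
    is_cartesian p l -> above p l t -> l ∘ m = g -> above p m s -> is_fib m;
  fttfc_cartesian_acof : forall (a b : E) (f : Hom a b),
    is_cartesian p f -> is_acof (fmap p f) -> is_acof f
}.

Record is_fibred_universe (w1 w0 : E) (w : Hom w1 w0) : Prop := {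
  funiverse_total : is_universe w;
  funiverse_base : is_universe (fmap p w);
  funiverse_lift : forall (a b : E) (f : Hom a b)
    (h : Hom (p b) (p w0)) (k : Hom (p a) (p w1)),
    is_small w f -> is_pullback k (fmap p f) (fmap p w) h ->
    exists (h' : Hom b w0) (k' : Hom a w1),
    is_pullback k' f w h' /\ fmap p h' = h /\ fmap p k' = k;
  funiverse_cartesian : forall (a b : E) (f : Hom a b),
    is_cartesian p f -> is_small (fmap p w) (fmap p f) -> is_small w f;
  funiverse_induced : forall (a c : E) (g : Hom a c)
    (j : B) (s : Hom (p a) j) (t : Hom j (p c)),
    is_small w g -> is_small (fmap p w) s -> t ∘ s = fmap p g ->
    forall (tc : E) (l : Hom tc c) (m : Hom a tc),
    is_cartesian p l -> above p l t -> l ∘ m = g -> above p m s -> is_small w m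
}.

End Fibred.

(** * Change of base *)

Section BaseChange.
Variables (A E B : fib_category) (p : functor E B) (F : functor A B).

Record bc_ob : Type := BcOb {
  bc_base : A;
  bc_total : E;
  bc_ob_above : p bc_total = F bc_base
}.

Record bc_hom (x y : bc_ob) : Type := BcHom {
  bc_fst : Hom (bc_base x) (bc_base y);
  bc_snd : Hom (bc_total x) (bc_total y);
  bc_hom_above : above p bc_snd (fmap F bc_fst)
}.

Lemma bc_hom_eq (x y : bc_ob) (f g : bc_hom x y) :
  bc_fst f = bc_fst g -> bc_snd f = bc_snd g -> f = g.
Proof.
destruct f as [s f Hf], g as [t g Hg]; simpl; intros -> ->.
now rewrite (proof_irrelevance _ Hf Hg).
Qed.

Lemma bc_id_above (x : bc_ob) :
  above p (idm (bc_total x)) (fmap F (idm (bc_base x))).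
Proof. rewrite fmap_id. apply above_id, bc_ob_above. Qed.

Definition bc_id (x : bc_ob) : bc_hom x x := BcHom (bc_id_above x).

Lemma bc_comp_above (x y z : bc_ob) (g : bc_hom y z) (f : bc_hom x y) :
  above p (bc_snd g ∘ bc_snd f) (fmap F (bc_fst g ∘ bc_fst f)).
Proof. rewrite fmap_comp. apply above_comp; apply bc_hom_above. Qed.

Definition bc_comp (x y z : bc_ob) (g : bc_hom y z) (f : bc_hom x y) :
  bc_hom x z := BcHom (bc_comp_above g f).

Definition bc_category : category.
Proof.
refine (@Category bc_ob bc_hom bc_id bc_comp _ _ _);
  intros; apply bc_hom_eq; simpl;
  solve [apply comp_assoc | apply comp_idl | apply comp_idr].
Defined.

Definition base_change : fib_category :=
  @FibCategory bc_category
    (fun x y (f : bc_hom x y) => is_fib (bc_fst f) /\ is_fib (bc_snd f)).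

Definition bc_proj : functor base_change A.
Proof.
refine (@Functor base_change A bc_base bc_fst _ _); reflexivity.
Defined.

End BaseChange.

(* Main.v *)
(* A morphism of F^*E is small for (v, h^*w) exactly when its components are
   v-small and w-small, because pullbacks of fibrations in F^*E are computed
   componentwise and h^*w is a pullback of w; so each axiom reduces to its
   instances for v and w.  Two of them need more.

   F need not preserve dependent products: the dependent product in F^*E is the
   pullback of the one in E along the comparison F(Π_g f) -> Π_(Fg)(Ff), and it
   is small because Π_g f is a small vertical morphism over a base change of C.

   Factoring A -> B above F(q1 i1): factor the induced A -> (F q1)^*B in E as
   A -> X -> (F q1)^*B.  Lifting F i1 against the image of the second factor
   gives a section σ of that image, and the middle object is σ^*X. *)
Require Import Defs.
From Stdlib Require Import ProofIrrelevance.

Set Implicit Arguments.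
Unset Strict Implicit.

(** * Pullbacks and dependent products in a category *)

Section Cat.
Variable C : category.

Lemma comp_post2 (a b c d : C) (g : Hom b c) (f : Hom a b) (m : Hom a c) :
  g ∘ f = m -> forall x : Hom c d, x ∘ g ∘ f = x ∘ m.
Proof. now intros <- x; rewrite comp_assoc. Qed.

Lemma comp_post3 (a b c d e : C) (g' : Hom c d) (g : Hom b c) (f : Hom a b)
    (m : Hom a d) :
  g' ∘ g ∘ f = m -> forall x : Hom d e, x ∘ g' ∘ g ∘ f = x ∘ m.
Proof. now intros <- x; rewrite !comp_assoc. Qed.

End Cat.

(* Rewriting modulo associativity; [H] must be associated to the left. *)
Ltac asc := repeat rewrite comp_assoc.
Ltac rw H :=
  asc; first [rewrite H | rewrite (comp_post2 H) | rewrite (comp_post3 H)]; asc.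
Ltac rwl H := let K := fresh in pose proof (eq_sym H) as K; rw K; clear K.

Section Pullbacks.
Variable C : category.

Lemma iso_id (a : C) : is_iso (idm a).
Proof. exists (idm a); split; apply comp_idl. Qed.

Lemma iso_comp (a b c : C) (g : Hom b c) (f : Hom a b) :
  is_iso g -> is_iso f -> is_iso (g ∘ f).
Proof.
intros [g' [Hg Hg']] [f' [Hf Hf']]; exists (f' ∘ g'); split.
- rw Hg. now rewrite comp_idr.
- rw Hf'. now rewrite comp_idr.
Qed.

Lemma iso_mono (a b x : C) (f : Hom a b) (m m' : Hom x a) :
  is_iso f -> f ∘ m = f ∘ m' -> m = m'.
Proof.
intros [g [H _]] E.
now rewrite <- (comp_idl m), <- (comp_idl m'), <- H, <- !comp_assoc, E.
Qed.

Lemma pb_fill (a b c d : C)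
    (k : Hom a c) (f : Hom a b) (q : Hom c d) (h : Hom b d) :
  is_pullback k f q h ->
  forall (x : C) (y : Hom x c) (z : Hom x b), q ∘ y = h ∘ z ->
  exists m : Hom x a, k ∘ m = y /\ f ∘ m = z.
Proof. intros [_ H] x y z E; destruct (H x y z E) as [m [Hm _]]; now exists m. Qed.

Lemma pb_eq (a b c d : C)
    (k : Hom a c) (f : Hom a b) (q : Hom c d) (h : Hom b d) :
  is_pullback k f q h ->
  forall (x : C) (m m' : Hom x a), k ∘ m = k ∘ m' -> f ∘ m = f ∘ m' -> m = m'.
Proof.
intros [H0 H] x m m' E1 E2.
destruct (H x (k ∘ m') (f ∘ m')) as [n [_ U]].
- now rewrite !comp_assoc, H0.
- now rewrite <- (U m), <- (U m').
Qed.

Lemma pb_intro (a b c d : C)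
    (k : Hom a c) (f : Hom a b) (q : Hom c d) (h : Hom b d) :
  q ∘ k = h ∘ f ->
  (forall (x : C) (y : Hom x c) (z : Hom x b), q ∘ y = h ∘ z ->
     exists m : Hom x a, k ∘ m = y /\ f ∘ m = z) ->
  (forall (x : C) (m m' : Hom x a), k ∘ m = k ∘ m' -> f ∘ m = f ∘ m' -> m = m') ->
  is_pullback k f q h.
Proof.
intros E H U; split; [exact E|]; intros x y z E'.
destruct (H x y z E') as [m [Hm1 Hm2]]; exists m; split; [easy|].
intros m' [H1 H2]; apply U; congruence.
Qed.

Lemma pb_paste (a b c d a' b' : C)
    (k : Hom a c) (f : Hom a b) (q : Hom c d) (h : Hom b d)
    (k' : Hom a' a) (f' : Hom a' b') (h' : Hom b' b) :
  is_pullback k f q h -> is_pullback k' f' f h' ->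
  is_pullback (k ∘ k') f' q (h ∘ h').
Proof.
intros P P'; pose proof (proj1 P) as E; pose proof (proj1 P') as E'.
apply pb_intro.
- rw E. now rw E'.
- intros x y z Hyz.
  destruct (pb_fill P (y := y) (z := h' ∘ z)) as [n [H1 H2]].
  { now rewrite Hyz, comp_assoc. }
  destruct (pb_fill P' H2) as [m [H3 H4]].
  exists m; split; [|easy]. now rw H3.
- intros x m m' H1 H2; apply (pb_eq P'); [|easy].
  apply (pb_eq P); [now asc|].
  rw E'. now rewrite <- !comp_assoc, H2.
Qed.

Lemma pb_cancel (a b c d a' b' : C)
    (k : Hom a c) (f : Hom a b) (q : Hom c d) (h : Hom b d)
    (k' : Hom a' a) (f' : Hom a' b') (h' : Hom b' b) :
  is_pullback k f q h -> f ∘ k' = h' ∘ f' ->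
  is_pullback (k ∘ k') f' q (h ∘ h') ->
  is_pullback k' f' f h'.
Proof.
intros P E' PP; pose proof (proj1 P) as E.
apply pb_intro; [easy| |].
- intros x y z Hyz.
  destruct (pb_fill PP (y := k ∘ y) (z := z)) as [m [H1 H2]].
  { rw E. now rw Hyz. }
  exists m; split; [|easy].
  apply (pb_eq P); [now asc|]. rw E'. now rw H2.
- intros x m m' H1 H2; apply (pb_eq PP); [|easy].
  now rewrite <- !comp_assoc, H1.
Qed.

Lemma pb_iso_h (a b c d : C)
    (k : Hom a c) (f : Hom a b) (q : Hom c d) (h : Hom b d) :
  q ∘ k = h ∘ f -> is_iso k -> is_iso h -> is_pullback k f q h.
Proof.
intros E Ik Ih; apply pb_intro; [easy| |].
- intros x y z Hyz; destruct Ik as [k' [H1 H2]].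
  exists (k' ∘ y); split.
  + rw H2. apply comp_idl.
  + apply (iso_mono Ih). rwl E. rw H2. now rewrite comp_idr.
- intros x m m' H _; now apply (iso_mono Ik).
Qed.

Lemma pb_iso_v (a b c d : C)
    (k : Hom a c) (f : Hom a b) (q : Hom c d) (h : Hom b d) :
  q ∘ k = h ∘ f -> is_iso f -> is_iso q -> is_pullback k f q h.
Proof.
intros E Jf Jq; apply pb_intro; [easy| |].
- intros x y z Hyz; destruct Jf as [f' [H1 H2]].
  exists (f' ∘ z); split.
  + apply (iso_mono Jq). rw E. rw H2. now rewrite comp_idr.
  + rw H2. apply comp_idl.
- intros x m m' _ H; now apply (iso_mono Jf).
Qed.

Lemma pb_unique (a a' b c d : C)
    (k : Hom a c) (f : Hom a b) (q : Hom c d) (h : Hom b d)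
    (k' : Hom a' c) (f' : Hom a' b) :
  is_pullback k f q h -> is_pullback k' f' q h ->
  exists m : Hom a' a, is_iso m /\ k ∘ m = k' /\ f ∘ m = f'.
Proof.
intros P P'.
destruct (pb_fill P (proj1 P')) as [m [H1 H2]].
destruct (pb_fill P' (proj1 P)) as [m' [H3 H4]].
exists m; split; [|easy]. exists m'; split.
- apply (pb_eq P'); rewrite comp_idr; [rw H3|rw H4]; easy.
- apply (pb_eq P); rewrite comp_idr; [rw H1|rw H2]; easy.
Qed.

Lemma pb_iso_dom (a a' b c d : C)
    (k : Hom a c) (f : Hom a b) (q : Hom c d) (h : Hom b d) (m : Hom a' a) :
  is_pullback k f q h -> is_iso m -> is_pullback (k ∘ m) (f ∘ m) q h.
Proof.
intros P I. rewrite <- (comp_idr h). apply (pb_paste P).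
apply pb_iso_h; [now rewrite comp_idl| easy | apply iso_id].
Qed.

Lemma over_eq (c x y : C) (f : Hom x c) (g : Hom y c) (k l : over f g) :
  proj1_sig k = proj1_sig l -> k = l.
Proof.
destruct k as [k Hk], l as [l Hl]; simpl; intros ->.
now rewrite (proof_irrelevance _ Hk Hl).
Qed.

Lemma transpose_inj (a b c pa : C) (f : Hom a b) (g : Hom b c) (pf : Hom pa c)
    (P : dep_prod f g pf) (x z : C) (h : Hom x c) (q : Hom z b) (r : Hom z x)
    (pb : is_pullback q r g h) (k l : over h pf) :
  transpose P pb k = transpose P pb l -> k = l.
Proof.
intros E. destruct (transpose_bij P pb (transpose P pb l)) as [n [_ U]].
now rewrite <- (U k), <- (U l).
Qed.

Lemma transpose_surj (a b c pa : C) (f : Hom a b) (g : Hom b c) (pf : Hom pa c)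
    (P : dep_prod f g pf) (x z : C) (h : Hom x c) (q : Hom z b) (r : Hom z x)
    (pb : is_pullback q r g h) (m : over q f) :
  exists k : over h pf, transpose P pb k = m.
Proof. destruct (transpose_bij P pb m) as [k [H _]]; now exists k. Qed.

(** Supplies the induced morphism [y] that [transpose_nat] asks for. *)
Lemma pb_over (b c x z x' z' : C) (g : Hom b c)
    (h : Hom x c) (q : Hom z b) (r : Hom z x)
    (h' : Hom x' c) (q' : Hom z' b) (r' : Hom z' x') :
  is_pullback q r g h -> is_pullback q' r' g h' ->
  forall s : over h' h, exists y : over q' q, r ∘ proj1_sig y = proj1_sig s ∘ r'.
Proof.
intros P P' [s Hs].
destruct (pb_fill P (y := q') (z := s ∘ r')) as [y [H1 H2]].
- rw Hs. apply (proj1 P').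
- now exists (exist _ y H1).
Qed.

(** Yoneda argument: [k] and [k'] correspond to the universal morphisms of [P] and [P'], so by
    naturality [k' ∘ k] and the identity have the same transpose under [P]. The form is symmetric,
    so that swapping the roles gives the other composite. *)
Lemma dep_prod_unique_retract (a b c pa pa' : C) (f : Hom a b) (g : Hom b c)
    (pf : Hom pa c) (pf' : Hom pa' c)
    (P : dep_prod f g pf) (P' : dep_prod f g pf')
    (z z' : C) (q : Hom z b) (r : Hom z pa) (q' : Hom z' b) (r' : Hom z' pa')
    (pb : is_pullback q r g pf) (pb' : is_pullback q' r' g pf')
    (k : over pf pf') (k' : over pf' pf) :
  transpose P' pb k = transpose P pb (exist _ (idm pa) (comp_idr pf)) ->
  transpose P pb' k' = transpose P' pb' (exist _ (idm pa') (comp_idr pf')) ->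
  proj1_sig k' ∘ proj1_sig k = idm pa.
Proof.
intros Hk Hk'.
destruct (pb_over pb' pb k) as [y Hy].
assert (E : over_comp k' k = exist _ (idm pa) (comp_idr pf)).
{ apply (transpose_inj (P := P) (pb := pb)).
  rewrite (transpose_nat P pb' pb Hy), Hk'.
  rewrite <- (transpose_nat P' pb' pb Hy), <- Hk.
  f_equal. apply over_eq; simpl. apply comp_idl. }
now apply (f_equal (@proj1_sig _ _)) in E.
Qed.

(** Closure of a universe under dependent products concerns all of them; this reduces it to a single
    one. The pullbacks along [pf] and [pf'] are where the identities of [pa] and [pa'] get
    transposed. *)
Lemma dep_prod_unique (a b c pa pa' : C) (f : Hom a b) (g : Hom b c)
    (pf : Hom pa c) (pf' : Hom pa' c)
    (P : dep_prod f g pf) (P' : dep_prod f g pf')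
    (z z' : C) (q : Hom z b) (r : Hom z pa) (q' : Hom z' b) (r' : Hom z' pa') :
  is_pullback q r g pf -> is_pullback q' r' g pf' ->
  exists k : Hom pa pa', is_iso k /\ pf' ∘ k = pf.
Proof.
intros pb pb'.
destruct (transpose_surj P' pb (transpose P pb (exist _ (idm pa) (comp_idr pf))))
  as [k Hk].
destruct (transpose_surj P pb' (transpose P' pb' (exist _ (idm pa') (comp_idr pf'))))
  as [k' Hk'].
exists (proj1_sig k); split; [|exact (proj2_sig k)].
exists (proj1_sig k'); split.
- exact (dep_prod_unique_retract Hk Hk').
- exact (dep_prod_unique_retract Hk' Hk).
Qed.

End Pullbacks.

(** * Images of squares and isomorphisms under a functor *)

Section Functor.
Variables (C D : category) (F : functor C D).

Lemma fmap_eq2 (a b c : C) (g : Hom b c) (f : Hom a b) (m : Hom a c) :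
  g ∘ f = m -> fmap F g ∘ fmap F f = fmap F m.
Proof. intros <-; symmetry; apply fmap_comp. Qed.

Lemma fmap_sq (a b b' c : C) (g : Hom b c) (f : Hom a b)
    (g' : Hom b' c) (f' : Hom a b') :
  g ∘ f = g' ∘ f' -> fmap F g ∘ fmap F f = fmap F g' ∘ fmap F f'.
Proof. intros E; now rewrite <- !fmap_comp, E. Qed.

Lemma fmap_iso (a b : C) (f : Hom a b) : is_iso f -> is_iso (fmap F f).
Proof.
intros [g [H1 H2]]; exists (fmap F g); now rewrite <- !fmap_comp, H1, H2, !fmap_id.
Qed.

End Functor.

(** * Small fibrations and acyclic cofibrations *)

Section Small.
Variable C : fib_category.

Lemma small_pullback (u1 u0 : C) (u : Hom u1 u0) (a b c d : C)
    (k : Hom a c) (f : Hom a b) (q : Hom c d) (h : Hom b d) :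
  is_pullback k f q h -> is_small u q -> is_small u f.
Proof.
intros P [h0 [k0 P0]]. exists (h0 ∘ h), (k0 ∘ k). exact (pb_paste P0 P).
Qed.

Lemma small_iso (u1 u0 : C) (u : Hom u1 u0) (a b : C) (f : Hom a b) :
  is_universe u -> is_iso f -> is_small u f.
Proof.
intros Hu I. apply (small_pullback (k := f) (q := idm b) (h := idm b)).
- apply pb_iso_v; [easy| easy | apply iso_id].
- apply (universe_id Hu).
Qed.

Lemma small_fib (HC : is_ttfc C) (u1 u0 : C) (u : Hom u1 u0) (a b : C) (f : Hom a b) :
  is_fib u -> is_small u f -> is_fib f.
Proof. intros Hu [h [k P]]; exact (ttfc_fib_pullback HC P Hu). Qed.

Lemma iso_acof (a b : C) (f : Hom a b) : is_iso f -> is_acof f.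
Proof.
intros [f' [H1 H2]] c d q _ m n Es; exists (m ∘ f'); split.
- rw H1. apply comp_idr.
- rw Es. rw H2. apply comp_idr.
Qed.

Lemma acof_comp (a b c : C) (g : Hom b c) (f : Hom a b) :
  is_acof g -> is_acof f -> is_acof (g ∘ f).
Proof.
intros Hg Hf x y q Hq m n E.
destruct (Hf x y q Hq m (n ∘ g)) as [l [H1 H2]]; [now rewrite E, comp_assoc|].
destruct (Hg x y q Hq l n H2) as [l' [H3 H4]].
exists l'; split; [|easy]. now rw H3.
Qed.

(* All objects are fibrant, so [n : b -> y] extends along [g]. *)
Lemma acof_cancel (HC : is_ttfc C) (a b c : C) (g : Hom b c) (f : Hom a b) :
  is_acof g -> is_acof (g ∘ f) -> is_acof f.
Proof.
intros Hg Hgf x y q Hq m n E.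
destruct (ttfc_terminal HC) as [t Ht].
destruct (Ht y) as [ty _], (Ht c) as [tc _].
destruct (Hg y t ty (ttfc_fib_terminal HC ty Ht) n tc) as [n' [H1 _]].
{ destruct (Ht b) as [tb [_ U]]. now rewrite <- (U (ty ∘ n)), <- (U (tc ∘ g)). }
destruct (Hgf x y q Hq m n') as [l [H2 H3]].
{ rw H1. exact E. }
exists (l ∘ g); split; [now rewrite <- comp_assoc|]. now rw H3.
Qed.

End Small.

(** * Cartesian morphisms *)

(* The isomorphism given by an equality of objects: it turns the heterogeneous
   relation [above] into a commutative square, see [above_iff]. *)
Definition eq_hom (B : category) (i j : B) (e : i = j) : Hom i j :=
  match e with eq_refl => idm i end.

Lemma eq_hom_iso (B : category) (i j : B) (e : i = j) : is_iso (eq_hom e).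
Proof. destruct e; apply iso_id. Qed.

Lemma eq_homK (B : category) (i j : B) (e : i = j) :
  eq_hom (eq_sym e) ∘ eq_hom e = idm i.
Proof. destruct e; apply comp_idl. Qed.

Lemma eq_hom_symK (B : category) (i j : B) (e : i = j) :
  eq_hom e ∘ eq_hom (eq_sym e) = idm j.
Proof. destruct e; apply comp_idl. Qed.

Section Cartesian.
Variables (E B : category) (p : functor E B).

Lemma above_iff (a a' : E) (f : Hom a a') (i i' : B) (s : Hom i i')
    (e : p a = i) (e' : p a' = i') :
  above p f s <-> eq_hom e' ∘ fmap p f = s ∘ eq_hom e.
Proof.
destruct e, e'; simpl; rewrite comp_idl, comp_idr; split.
- intros H; apply aboveE in H; destruct H as [e [e' H]].
  now rewrite (proof_irrelevance _ e eq_refl), (proof_irrelevance _ e' eq_refl) in H.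
- intros <-; apply Above.
Qed.

Lemma above_eq (a a' : E) (f : Hom a a') (s : Hom (p a) (p a')) :
  above p f s -> fmap p f = s.
Proof.
intros H; apply (above_iff f s eq_refl eq_refl) in H; simpl in H.
now rewrite comp_idl, comp_idr in H.
Qed.

Lemma cart_fill (a b c : E) (f : Hom a b) (g : Hom c b) (s : Hom (p c) (p a)) :
  is_cartesian p f -> fmap p f ∘ s = fmap p g ->
  exists m : Hom c a, f ∘ m = g /\ fmap p m = s.
Proof. intros H Es; destruct (H c g s Es) as [m [Hm _]]; now exists m. Qed.

Lemma cart_eq (a b c : E) (f : Hom a b) (m m' : Hom c a) :
  is_cartesian p f -> f ∘ m = f ∘ m' -> fmap p m = fmap p m' -> m = m'.
Proof.
intros H E1 E2. destruct (H c (f ∘ m') (fmap p m')) as [n [_ U]].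
- symmetry; apply fmap_comp.
- now rewrite <- (U m), <- (U m').
Qed.

Lemma cart_intro (a b : E) (f : Hom a b) :
  (forall (c : E) (g : Hom c b) (s : Hom (p c) (p a)), fmap p f ∘ s = fmap p g ->
     exists m : Hom c a, f ∘ m = g /\ fmap p m = s) ->
  (forall (c : E) (m m' : Hom c a),
     f ∘ m = f ∘ m' -> fmap p m = fmap p m' -> m = m') ->
  is_cartesian p f.
Proof.
intros H U c g s Es; destruct (H c g s Es) as [m [H1 H2]]; exists m; split; [easy|].
intros m' [H3 H4]; apply U; congruence.
Qed.

Lemma cart_iso (a b : E) (f : Hom a b) : is_iso f -> is_cartesian p f.
Proof.
intros I; apply cart_intro.
- intros c g s Es; pose proof I as [f' [H1 H2]]; exists (f' ∘ g); split.
  + rw H2. apply comp_idl.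
  + apply (iso_mono (fmap_iso p I)). rewrite Es, <- fmap_comp.
    rw H2. now rewrite comp_idl.
- intros c m m' H _; exact (iso_mono I H).
Qed.

Lemma cart_comp (a b c : E) (g : Hom b c) (f : Hom a b) :
  is_cartesian p g -> is_cartesian p f -> is_cartesian p (g ∘ f).
Proof.
intros Hg Hf; apply cart_intro.
- intros x n s Es.
  destruct (cart_fill (g := n) (s := fmap p f ∘ s) Hg) as [m [H1 H2]].
  { now rewrite <- Es, fmap_comp, comp_assoc. }
  destruct (cart_fill (g := m) (s := s) Hf) as [m' [H3 H4]]; [easy|].
  exists m'; split; [|easy]. now rw H3.
- intros x m m' H1 H2; apply (cart_eq Hf); [|easy].
  apply (cart_eq Hg); [now asc|]. now rewrite !fmap_comp, H2.
Qed.

Lemma cart_cancel (a b c : E) (g : Hom b c) (f : Hom a b) :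
  is_cartesian p g -> is_cartesian p (g ∘ f) -> is_cartesian p f.
Proof.
intros Hg Hgf; apply cart_intro.
- intros x n s Es.
  destruct (cart_fill (g := g ∘ n) (s := s) Hgf) as [m [H1 H2]].
  { rewrite !fmap_comp. now rw Es. }
  exists m; split; [|easy]. apply (cart_eq Hg); [now asc|].
  now rewrite fmap_comp, H2.
- intros x m m' H1 H2; apply (cart_eq Hgf); [|easy].
  now rewrite <- !comp_assoc, H1.
Qed.

Lemma cart_over_iso (a b : E) (f : Hom a b) :
  is_cartesian p f -> is_iso (fmap p f) -> is_iso f.
Proof.
intros H [s [H1 H2]].
destruct (cart_fill (g := idm b) (s := s) H) as [m [H3 H4]].
{ now rewrite H2, fmap_id. }
exists m; split; [|easy].
apply (cart_eq H).
- rw H3. now rewrite comp_idl, comp_idr.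
- now rewrite fmap_comp, H4, H1, fmap_id.
Qed.

Lemma cart_lift (b : E) (i : B) (s : Hom i (p b)) : is_fibred_category p ->
  exists (a : E) (f : Hom a b) (e : p a = i),
  is_cartesian p f /\ fmap p f = s ∘ eq_hom e.
Proof.
intros Hp; destruct (Hp b i s) as [a [f [Hf H]]].
exists a, f, (above_dom H); split; [easy|].
pose proof (proj1 (above_iff f s (above_dom H) eq_refl) H) as H'; simpl in H'.
now rewrite comp_idl in H'.
Qed.

(** A cone is first filled in the base; cartesianness of [k] lifts the filler, and that of [h] shows
    that the lift has the right component into [b]. *)
Lemma cart_pullback (a b c d : E)
    (k : Hom a c) (f : Hom a b) (q : Hom c d) (h : Hom b d) :
  is_cartesian p k -> is_cartesian p h -> q ∘ k = h ∘ f ->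
  is_pullback (fmap p k) (fmap p f) (fmap p q) (fmap p h) ->
  is_pullback k f q h.
Proof.
intros Hk Hh Es P; apply pb_intro; [easy| |].
- intros x y z Hyz.
  destruct (pb_fill P (fmap_sq p Hyz)) as [s [H1 H2]].
  destruct (cart_fill Hk H1) as [m [H3 H4]].
  exists m; split; [easy|]. apply (cart_eq Hh).
  + rwl Es. now rw H3.
  + now rewrite fmap_comp, H4.
- intros x m m' H1 H2; apply (cart_eq Hk); [easy|].
  apply (pb_eq P); now rewrite <- !fmap_comp, ?H1, ?H2.
Qed.

(* [n] is the pullback along [cX] of the comparison [X -> (pq)^* Y]. *)
Lemma vertical_stable (Hp : is_fibred_category p)
    (S : forall a b : E, Hom a b -> Prop)
    (S_pb : forall (a b c d : E)
      (k : Hom a c) (f : Hom a b) (q : Hom c d) (h : Hom b d),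
      is_pullback k f q h -> S _ _ q -> S _ _ f)
    (S_ind : forall (a c tc : E) (g : Hom a c) (l : Hom tc c) (m : Hom a tc),
      S _ _ g -> is_cartesian p l -> l ∘ m = g -> is_iso (fmap p m) -> S _ _ m)
    (X Y x y : E) (q : Hom X Y) (cX : Hom x X) (cY : Hom y Y) (n : Hom x y) :
  S _ _ q -> is_cartesian p cX -> is_cartesian p cY ->
  cY ∘ n = q ∘ cX -> is_iso (fmap p n) -> S _ _ n.
Proof.
intros Sq HX HY En In.
destruct (cart_lift (fmap p q) Hp) as [Y2 [L [e [HL HpL]]]].
pose proof (eq_hom_iso e) as Ie; pose proof Ie as [e' [Ie1 Ie2]].
destruct (cart_fill (g := q) (s := e') HL) as [m [Hm Hpm]].
{ rewrite HpL. rw Ie2. apply comp_idr. }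
assert (Im : is_iso (fmap p m)) by (rewrite Hpm; now exists (eq_hom e)).
pose proof In as [r [Ir1 Ir2]].
(* As [p n] is invertible, [p cY] factors through [p q], hence [cY] through the cartesian lift [L]
   of [p q]. *)
destruct (cart_fill (g := cY) (s := e' ∘ fmap p cX ∘ r) HL) as [d [Hd Hpd]].
{ rewrite HpL. rw Ie2. rewrite comp_idr. rewrite <- fmap_comp, <- En, fmap_comp.
  rw Ir2. apply comp_idr. }
assert (Cd : is_cartesian p d) by (apply (cart_cancel HL); now rewrite Hd).
assert (Esq : m ∘ cX = d ∘ n).
{ apply (cart_eq HL).
  - rw Hm. now rw Hd.
  - rewrite !fmap_comp, Hpm, Hpd. rw Ir1. now rewrite comp_idr. }
apply (S_pb _ _ _ _ cX n m d).
- apply cart_pullback; [easy|easy|easy|].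
  apply pb_iso_v; [exact (fmap_sq p Esq)| easy|easy].
- exact (S_ind _ _ _ _ _ _ Sq HL Hm Im).
Qed.

End Cartesian.

(** * Vertical morphisms, lifting and factorization above given base data *)

Section FibredTtfc.
Variables (E B : fib_category) (p : functor E B).
Hypothesis Hp : is_fibred_ttfc p.

Let HE := fttfc_total Hp.
Let HB := fttfc_base Hp.

(** The comparison into a base change is a fibration by the induced-morphism axiom, whose base
    fibration is here an isomorphism. [vertical_small] is the same with isomorphisms being small. *)
Lemma vertical_fib (X Y x y : E)
    (q : Hom X Y) (cX : Hom x X) (cY : Hom y Y) (n : Hom x y) :
  is_fib q -> is_cartesian p cX -> is_cartesian p cY ->
  cY ∘ n = q ∘ cX -> is_iso (fmap p n) -> is_fib n.
Proof.
apply (vertical_stable (fttfc_fibred Hp) (S := @is_fib E)).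
- intros a b c d k f g h P; exact (ttfc_fib_pullback HE P).
- intros a c tc g l m Sg Hl Hm Im.
  refine (fttfc_induced Hp (g := g) Sg _ _ Hl (Above p l) Hm (Above p m)).
  + now rewrite <- Hm, fmap_comp.
  + exact (ttfc_fib_iso HB Im).
Qed.

Lemma vertical_small (w1 w0 : E) (w : Hom w1 w0) (Hw : is_fibred_universe p w)
    (X Y x y : E) (q : Hom X Y) (cX : Hom x X) (cY : Hom y Y) (n : Hom x y) :
  is_small w q -> is_cartesian p cX -> is_cartesian p cY ->
  cY ∘ n = q ∘ cX -> is_iso (fmap p n) -> is_small w n.
Proof.
apply (vertical_stable (fttfc_fibred Hp) (S := @is_small E w1 w0 w)).
- intros a b c d k f g h P; exact (small_pullback P).
- intros a c tc g l m Sg Hl Hm Im.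
  refine (funiverse_induced Hw (g := g) Sg _ _ Hl (Above p l) Hm (Above p m)).
  + exact (small_iso (funiverse_base Hw) Im).
  + now rewrite <- Hm, fmap_comp.
Qed.

(* Pulling the square back along [l] reduces to a lifting problem against a
   fibration whose image in [B] is invertible. *)
Lemma lift_above (a b c d : E) (i : Hom a b) (q : Hom c d)
    (f : Hom a c) (g : Hom b d) (l : Hom (p b) (p c)) :
  is_acof i -> is_fib q -> q ∘ f = g ∘ i ->
  l ∘ fmap p i = fmap p f -> fmap p q ∘ l = fmap p g ->
  exists m : Hom b c, m ∘ i = f /\ q ∘ m = g /\ fmap p m = l.
Proof.
intros Hi Hq Esq El1 El2. pose proof (fttfc_fibred Hp) as Hfib.
(* [c'] is [l^*c] and [d'] is [(p g)^*d], both over [p b]; since [p q ∘ l = p g], [q] induces [n]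
   between them with [p n] invertible. *)
destruct (cart_lift l Hfib) as [c' [cc [e [Hcc Hpcc]]]].
destruct (cart_lift (fmap p g) Hfib) as [d' [cd [e2 [Hcd Hpcd]]]].
pose proof (eq_hom_iso e) as Ie; pose proof Ie as [r [Ie1 Ie2]].
pose proof (eq_hom_iso e2) as Ie'; pose proof Ie' as [r2 [Ie1' Ie2']].
destruct (cart_fill (g := q ∘ cc) (s := r2 ∘ eq_hom e) Hcd) as [n [Hn Hpn]].
{ rewrite Hpcd, fmap_comp, Hpcc. rw Ie2'. rewrite comp_idr. now rw El2. }
assert (In : is_iso (fmap p n)).
{ rewrite Hpn. apply iso_comp; [now exists (eq_hom e2)|easy]. }
assert (Fn : is_fib n) by exact (vertical_fib Hq Hcc Hcd Hn In).
destruct (cart_fill (g := f) (s := r ∘ fmap p i) Hcc) as [f' [Hf' Hpf']].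
{ rewrite Hpcc. rw Ie2. now rewrite comp_idr. }
destruct (cart_fill (g := g) (s := r2) Hcd) as [g' [Hg' Hpg']].
{ rewrite Hpcd. rw Ie2'. apply comp_idr. }
destruct (Hi c' d' n Fn f' g') as [m [Hm1 Hm2]].
{ apply (cart_eq Hcd).
  - rw Hn. rw Hg'. rw Hf'. easy.
  - rewrite !fmap_comp, Hpn, Hpf', Hpg'. rw Ie2. now rewrite comp_idr. }
exists (cc ∘ m); repeat split.
- now rw Hm1.
- rwl Hn. now rw Hm2.
- rewrite fmap_comp, Hpcc.
  (* The images of [n] and [g'] are known, so [n ∘ m = g'] determines [p m]; this puts the lift
     above [l]. *)
  assert (K : eq_hom e ∘ fmap p m = idm (p b)).
  { apply (iso_mono (f := r2)); [now exists (eq_hom e2)|].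
    asc. now rewrite <- Hpn, <- fmap_comp, Hm2, comp_idr. }
  rw K. apply comp_idr.
Qed.

(* In the proof, [z ∘ j] factors the morphism induced by [m] into [q^* b], and
   [sg] is a section of [p z] extending [p j] along [i].  The first factor
   [a -> sg^* x] passes through [(p j)^* x]: the first part is an acyclic
   cofibration by [acof_cancel], the second is cartesian above [i]. *)
Lemma small_factor_above (w1 w0 : E) (w : Hom w1 w0) (Hw : is_fibred_universe p w)
    (a b c : E) (f : Hom a c) (g : Hom b c) (m : Hom a b)
    (n : B) (i : Hom (p a) n) (q : Hom n (p b)) :
  is_small w f -> is_small w g -> g ∘ m = f ->
  is_acof i -> is_small (fmap p w) q -> q ∘ i = fmap p m ->
  exists (y : E) (e : p y = n) (i' : Hom a y) (q' : Hom y b),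
  is_acof i' /\ is_small w q' /\ q' ∘ i' = m /\
  eq_hom e ∘ fmap p i' = i /\ fmap p q' = q ∘ eq_hom e.
Proof.
intros Sf Sg Em Hi Hq Ei. pose proof (fttfc_fibred Hp) as Hfib.
destruct (cart_lift q Hfib) as [b' [cb [e [Hcb Hpcb]]]].
pose proof (eq_hom_iso e) as Ie; pose proof Ie as [r [Ie1 Ie2]].
assert (Ir : is_iso r) by now exists (eq_hom e).
assert (Scb : is_small w cb).
{ apply (funiverse_cartesian Hw Hcb). rewrite Hpcb.
  apply (universe_comp (funiverse_base Hw) Hq). exact (small_iso (funiverse_base Hw) Ie). }
destruct (cart_fill (g := m) (s := r ∘ i) Hcb) as [m' [Hm' Hpm']].
{ rewrite Hpcb. rw Ie2. now rewrite comp_idr. }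
(* The factorization axiom applies to [m' : a -> b'] because both [f] and [g ∘ cb] are small over
   [c]. *)
destruct (universe_factor (funiverse_total Hw) (f := f) (g := g ∘ cb) (m := m'))
  as [x [j [z [Hj [Sz Ez]]]]].
{ easy. }
{ exact (universe_comp (funiverse_total Hw) Sg Scb). }
{ now rw Hm'. }
assert (Fz : is_fib z).
{ exact (small_fib HE (universe_fib (funiverse_total Hw)) Sz). }
pose proof (ttf_fib (fttfc_functor Hp) Fz) as Fpz.
pose proof (ttf_acof (fttfc_functor Hp) Hj) as Hpj.
(* The square commutes because [p m' = r ∘ i]. As [r] identifies [n] with [p b'], [sg] is a section
   of [p z] up to this identification. *)
destruct (Hi _ _ _ Fpz (fmap p j) r) as [sg [Hs1 Hs2]].
{ now rewrite <- fmap_comp, Ez. }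
(* [y] is [sg^*x] and [t] is [(p j)^*x]; [sg ∘ i = p j] yields [b0 : t -> y] above [i], and [j]
   induces [a0 : a -> t]. *)
destruct (cart_lift sg Hfib) as [y [cy [ey [Hcy Hpcy]]]].
pose proof (eq_hom_iso ey) as Iey; pose proof Iey as [ry [Iy1 Iy2]].
destruct (cart_lift (fmap p j) Hfib) as [t [ct [et [Hct Hpct]]]].
pose proof (eq_hom_iso et) as Iet; pose proof Iet as [rt [It1 It2]].
destruct (cart_fill (g := ct) (s := ry ∘ i ∘ eq_hom et) Hcy) as [b0 [Hb0 Hpb0]].
{ rewrite Hpcy, Hpct. rw Iy2. rewrite comp_idr. now rw Hs1. }
destruct (cart_fill (g := j) (s := rt) Hct) as [a0 [Ha0 Hpa0]].
{ rewrite Hpct. rw It2. apply comp_idr. }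
assert (Act : is_acof ct).
{ apply (fttfc_cartesian_acof Hp Hct). rewrite Hpct.
  apply acof_comp; [easy|now apply iso_acof]. }
assert (Ab0 : is_acof b0).
{ apply (fttfc_cartesian_acof Hp).
  - apply (cart_cancel Hcy). now rewrite Hb0.
  - rewrite Hpb0. apply acof_comp; [apply acof_comp; [|easy]|]; apply iso_acof; [|easy].
    now exists (eq_hom ey). }
assert (Aa0 : is_acof a0).
{ apply (acof_cancel HE Act). now rewrite Ha0. }
(* [p z ∘ sg = r] makes [z ∘ cy] lie above an isomorphism, so it is its own vertical part: the
   second cartesian morphism is an identity. *)
assert (Szy : is_small w (z ∘ cy)).
{ apply (vertical_small Hw Sz Hcy (cY := idm b') (n := z ∘ cy)).
  - apply cart_iso, iso_id.
  - apply comp_idl.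
  - rewrite fmap_comp, Hpcy. rw Hs2. now apply iso_comp. }
exists y, ey, (b0 ∘ a0), (cb ∘ (z ∘ cy)); repeat split.
- now apply acof_comp.
- exact (universe_comp (funiverse_total Hw) Scb Szy).
- rw Hb0. rw Ha0. now rw Ez.
- rewrite fmap_comp, Hpb0, Hpa0. rw Iy2. rewrite comp_idl. rw It2. apply comp_idr.
- rewrite !fmap_comp, Hpcb, Hpcy. rw Hs2. rw Ie2. now rewrite comp_idr.
Qed.

End FibredTtfc.

(** * Pullbacks in a change of base *)

Section BaseChangeTheory.
Variables (A E B : fib_category) (p : functor E B) (F : functor A B).

Notation bc := (base_change p F).

Definition bc_eq (x : bc) : Hom (p (bc_total x)) (F (bc_base x)) :=
  eq_hom (bc_ob_above x).

Definition bc_inv (x : bc) : Hom (F (bc_base x)) (p (bc_total x)) :=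
  eq_hom (eq_sym (bc_ob_above x)).

Lemma bc_eqK (x : bc) : bc_inv x ∘ bc_eq x = idm _.
Proof. apply eq_homK. Qed.

Lemma bc_invK (x : bc) : bc_eq x ∘ bc_inv x = idm _.
Proof. apply eq_hom_symK. Qed.

Lemma bc_eq_iso (x : bc) : is_iso (bc_eq x).
Proof. apply eq_hom_iso. Qed.

Lemma bc_inv_iso (x : bc) : is_iso (bc_inv x).
Proof. apply eq_hom_iso. Qed.

Lemma bc_sq (x y : bc) (f : Hom x y) :
  bc_eq y ∘ fmap p (bc_snd f) = fmap F (bc_fst f) ∘ bc_eq x.
Proof. apply above_iff, bc_hom_above. Qed.

Lemma bc_sq' (x y : bc) (f : Hom x y) :
  fmap p (bc_snd f) = bc_inv y ∘ fmap F (bc_fst f) ∘ bc_eq x.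
Proof. rwl (bc_sq f). rewrite bc_eqK. now rewrite comp_idl. Qed.

Lemma bc_sq_inv (x y : bc) (f : Hom x y) :
  fmap p (bc_snd f) ∘ bc_inv x = bc_inv y ∘ fmap F (bc_fst f).
Proof. rewrite bc_sq'. rw (bc_invK x). now rewrite comp_idr. Qed.

Definition bc_mk (x y : bc) (s : Hom (bc_base x) (bc_base y))
    (t : Hom (bc_total x) (bc_total y))
    (H : bc_eq y ∘ fmap p t = fmap F s ∘ bc_eq x) : @Hom bc x y :=
  BcHom (proj2 (above_iff t (fmap F s) (bc_ob_above x) (bc_ob_above y)) H).

Lemma bc_ext (x y : bc) (f g : Hom x y) :
  bc_fst f = bc_fst g -> bc_snd f = bc_snd g -> f = g.
Proof. apply bc_hom_eq. Qed.

Lemma bc_snd_comp (x y z : bc) (g : Hom y z) (f : Hom x y) :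
  bc_snd (g ∘ f) = bc_snd g ∘ bc_snd f.
Proof. reflexivity. Qed.

Lemma bc_fst_eq (x y z : bc) (g : Hom y z) (f : Hom x y) (m : Hom x z) :
  g ∘ f = m -> bc_fst g ∘ bc_fst f = bc_fst m.
Proof. now intros <-. Qed.

Lemma bc_snd_eq (x y z : bc) (g : Hom y z) (f : Hom x y) (m : Hom x z) :
  g ∘ f = m -> bc_snd g ∘ bc_snd f = bc_snd m.
Proof. now intros <-. Qed.

Lemma bc_iso_fst (x y : bc) (f : Hom x y) : is_iso f -> is_iso (bc_fst f).
Proof.
intros [g [H1 H2]]; exists (bc_fst g); split; [apply (bc_fst_eq H1)|apply (bc_fst_eq H2)].
Qed.

Lemma bc_iso_snd (x y : bc) (f : Hom x y) : is_iso f -> is_iso (bc_snd f).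
Proof.
intros [g [H1 H2]]; exists (bc_snd g); split; [apply (bc_snd_eq H1)|apply (bc_snd_eq H2)].
Qed.

(** The fillers found in [A] and [E] must form a morphism of [F^*E]; this equation in [B] is checked
    on the two projections of the image under [F], whence the third hypothesis. *)
Lemma bc_pb_intro (a b c d : bc)
    (k : Hom a c) (f : Hom a b) (q : Hom c d) (h : Hom b d) :
  is_pullback (bc_fst k) (bc_fst f) (bc_fst q) (bc_fst h) ->
  is_pullback (bc_snd k) (bc_snd f) (bc_snd q) (bc_snd h) ->
  is_pullback (fmap F (bc_fst k)) (fmap F (bc_fst f))
    (fmap F (bc_fst q)) (fmap F (bc_fst h)) ->
  is_pullback k f q h.
Proof.
intros P1 P2 PF; apply pb_intro.
- apply bc_ext; [apply P1|apply P2].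
- intros x y z Hyz.
  destruct (pb_fill P1 (bc_fst_eq Hyz)) as [m1 [H1 H2]].
  destruct (pb_fill P2 (bc_snd_eq Hyz)) as [m2 [H3 H4]].
  assert (H : bc_eq a ∘ fmap p m2 = fmap F m1 ∘ bc_eq x).
  { apply (pb_eq PF); asc.
    - rwl (bc_sq k). rw (fmap_eq2 p H3). rewrite (bc_sq y).
      now rw (fmap_eq2 F H1).
    - rwl (bc_sq f). rw (fmap_eq2 p H4). rewrite (bc_sq z).
      now rw (fmap_eq2 F H2). }
  exists (bc_mk H); split; apply bc_ext; easy.
- intros x m m' H1 H2; apply bc_ext.
  + apply (pb_eq P1); [exact (bc_fst_eq H1)|exact (bc_fst_eq H2)].
  + apply (pb_eq P2); [exact (bc_snd_eq H1)|exact (bc_snd_eq H2)].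
Qed.

(** Here [a1] and [b1] carry no total object: this serves for a dependent product in [A] before an
    object above it has been built. *)
Lemma pb_conj_cospan (c d : bc) (a1 b1 : A)
    (k : Hom a1 (bc_base c)) (f : Hom a1 b1) (q : Hom c d) (h : Hom b1 (bc_base d)) :
  is_pullback (fmap F k) (fmap F f) (fmap F (bc_fst q)) (fmap F h) ->
  is_pullback (bc_inv c ∘ fmap F k) (fmap F f)
    (fmap p (bc_snd q)) (bc_inv d ∘ fmap F h).
Proof.
apply pb_paste, pb_iso_h; [apply bc_sq_inv| |]; apply bc_inv_iso.
Qed.

Lemma pb_conj (b c d : bc) (a1 : A)
    (k : Hom a1 (bc_base c)) (f : Hom a1 (bc_base b)) (q : Hom c d) (h : Hom b d) :
  is_pullback (fmap F k) (fmap F f) (fmap F (bc_fst q)) (fmap F (bc_fst h)) ->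
  is_pullback (bc_inv c ∘ fmap F k) (bc_inv b ∘ fmap F f)
    (fmap p (bc_snd q)) (fmap p (bc_snd h)).
Proof.
intros P; pose proof (pb_conj_cospan P) as P'.
apply pb_intro.
- rw (bc_sq_inv q). rw (bc_sq_inv h). now rw (proj1 P).
- intros x y z Hyz.
  destruct (pb_fill P' (y := y) (z := bc_eq b ∘ z)) as [m [H1 H2]].
  { rewrite Hyz, bc_sq'. now asc. }
  exists m; split; [easy|]. rw H2. rewrite bc_eqK. apply comp_idl.
- intros x m m' H1 H2. apply (pb_eq P'); [easy|].
  apply (iso_mono (bc_inv_iso b)). now asc.
Qed.

Hypothesis Hp : is_fibred_ttfc p.
Hypothesis HA : is_ttfc A.
Hypothesis HFpb : preserves_fib_pullback F.

Let Hfib := fttfc_fibred Hp.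
Let HE := fttfc_total Hp.

(** The pullbacks in [A] and [E] have vertices whose images in [B] are only isomorphic, both being
    pullbacks of the same cospan. A cartesian lift [th] of this isomorphism replaces the vertex in
    [E] by an isomorphic one lying strictly above. *)
Lemma bc_pb_exists (b c d : bc) (q : Hom c d) (h : Hom b d) : is_fib q ->
  exists (a : bc) (k : Hom a c) (f : Hom a b),
  is_pullback (bc_fst k) (bc_fst f) (bc_fst q) (bc_fst h) /\
  is_pullback (bc_snd k) (bc_snd f) (bc_snd q) (bc_snd h) /\
  is_pullback k f q h.
Proof.
intros [Fq1 Fq2].
destruct (ttfc_pullback HA (bc_fst h) Fq1) as [a1 [k1 [f1 P1]]].
destruct (ttfc_pullback HE (bc_snd h) Fq2) as [a2 [k2 [f2 P2]]].
pose proof (HFpb Fq1 P1) as PF.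
pose proof (ttf_fib_pullback (fttfc_functor Hp) Fq2 P2) as Pp.
destruct (pb_unique Pp (pb_conj PF)) as [r [Ir [H1 H2]]].
destruct (cart_lift r Hfib) as [x [th [e [Hth Hpth]]]].
assert (Ith : is_iso th).
{ apply (cart_over_iso Hth). rewrite Hpth. apply iso_comp; [easy|apply eq_hom_iso]. }
pose (a := BcOb e : bc).
assert (Hk : bc_eq c ∘ fmap p (k2 ∘ th : Hom (bc_total a) _) = fmap F k1 ∘ bc_eq a).
{ rewrite fmap_comp, Hpth. rw H1. rewrite bc_invK. now rewrite comp_idl. }
assert (Hf : bc_eq b ∘ fmap p (f2 ∘ th : Hom (bc_total a) _) = fmap F f1 ∘ bc_eq a).
{ rewrite fmap_comp, Hpth. rw H2. rewrite bc_invK. now rewrite comp_idl. }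
assert (P2' : is_pullback (k2 ∘ th) (f2 ∘ th) (bc_snd q) (bc_snd h)).
{ now apply pb_iso_dom. }
exists a, (bc_mk Hk), (bc_mk Hf); split; [|split]; [easy|easy|].
now apply bc_pb_intro.
Qed.

(** Any pullback is isomorphic to the componentwise one of [bc_pb_exists]. *)
Lemma bc_pb_components (a b c d : bc)
    (k : Hom a c) (f : Hom a b) (q : Hom c d) (h : Hom b d) :
  is_fib q -> is_pullback k f q h ->
  is_pullback (bc_fst k) (bc_fst f) (bc_fst q) (bc_fst h) /\
  is_pullback (bc_snd k) (bc_snd f) (bc_snd q) (bc_snd h).
Proof.
intros Fq P.
destruct (bc_pb_exists h Fq) as [a' [k' [f' [P1 [P2 P']]]]].
destruct (pb_unique P' P) as [m [Im [<- <-]]]. split.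
- exact (pb_iso_dom P1 (bc_iso_fst Im)).
- exact (pb_iso_dom P2 (bc_iso_snd Im)).
Qed.

(** Lift in [A] first; [lift_above] then gives a lift in [E] above its image. *)
Lemma bc_acof (a b : bc) (i : Hom a b) :
  is_acof (bc_fst i) -> is_acof (bc_snd i) -> is_acof i.
Proof.
intros H1 H2 c d q [Fq1 Fq2] f g Es.
destruct (H1 _ _ _ Fq1 _ _ (bc_fst_eq Es)) as [l1 [L1 L2]].
destruct (lift_above Hp (l := bc_inv c ∘ fmap F l1 ∘ bc_eq b) H2 Fq2 (bc_snd_eq Es))
  as [l2 [L3 [L4 L5]]].
- rw (bc_sq i). rw (fmap_eq2 F L1). now rewrite bc_sq'.
- rw (bc_sq_inv q). rw (fmap_eq2 F L2). now rewrite bc_sq'.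
- assert (H : bc_eq c ∘ fmap p l2 = fmap F l1 ∘ bc_eq b).
  { rewrite L5. asc. rewrite bc_invK. now rewrite comp_idl. }
  exists (bc_mk H); split; apply bc_ext; easy.
Qed.

(** A cartesian lift in [E] of the image of [bc_fst f] gives a morphism [l] of [F^*E] with the same
    base component; the universal properties of [f] and [l] make their domains isomorphic. *)
Lemma bc_cart_snd (x y : bc) (f : Hom x y) :
  is_cartesian (bc_proj p F) f -> is_cartesian p (bc_snd f).
Proof.
intros Hf.
destruct (cart_lift (bc_inv y ∘ fmap F (bc_fst f)) Hfib) as [x2 [l2 [e [Hl Hpl]]]].
pose (x' := BcOb e : bc).
assert (Hl2 : bc_eq y ∘ fmap p (l2 : Hom (bc_total x') _)
  = fmap F (bc_fst f) ∘ bc_eq x').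
{ transitivity (bc_eq y ∘ (bc_inv y ∘ fmap F (bc_fst f) ∘ eq_hom e));
    [exact (f_equal (comp (bc_eq y)) Hpl)|]. asc. rewrite bc_invK. now rewrite comp_idl. }
pose (l := bc_mk Hl2 : @Hom bc x' y).
destruct (cart_fill (p := bc_proj p F) (a := x) (c := x') (g := l)
  (s := idm (bc_base x)) Hf) as [m [Hm1 Hm2]].
{ apply comp_idr. }
destruct (cart_fill (g := bc_snd f) (s := eq_hom (eq_sym e) ∘ bc_eq x) Hl)
  as [n2 [Hn1 Hn2]].
{ rewrite Hpl. rw (eq_hom_symK e). rewrite comp_idr. symmetry. apply bc_sq'. }
assert (Hn : bc_eq x' ∘ fmap p (n2 : Hom _ (bc_total x'))
  = fmap F (idm (bc_base x)) ∘ bc_eq x).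
{ transitivity (eq_hom e ∘ (eq_hom (eq_sym e) ∘ bc_eq x));
    [exact (f_equal (comp (bc_eq x')) Hn2)|]. rw (eq_hom_symK e). now rewrite fmap_id. }
pose (n := bc_mk Hn : @Hom bc x x').
simpl in Hm2.
assert (Hm : fmap p (bc_snd m) = bc_inv x ∘ eq_hom e).
{ transitivity (bc_inv x ∘ fmap F (bc_fst m) ∘ bc_eq x'); [apply bc_sq'|].
  rewrite Hm2. transitivity (bc_inv x ∘ idm _ ∘ bc_eq x').
  - now rewrite <- fmap_id.
  - now rewrite comp_idr. }
assert (In : is_iso n2).
{ exists (bc_snd m); split.
  - change (bc_snd (m ∘ n) = bc_snd (idm x)). f_equal.
    apply (cart_eq Hf).
    + rw Hm1. rewrite comp_idr.
      apply bc_ext; [apply comp_idr|apply Hn1].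
    + change (bc_fst m ∘ idm (bc_base x) = idm (bc_base x)). rewrite Hm2. apply comp_idl.
  - apply (cart_eq Hl).
    + rw Hn1. rewrite comp_idr. exact (bc_snd_eq Hm1).
    + transitivity (fmap p n2 ∘ fmap p (bc_snd m)); [exact (fmap_comp _ _ _)|].
      rewrite Hm, Hn2, fmap_id. rw (bc_invK x). rewrite comp_idr. apply eq_homK. }
rewrite <- Hn1. apply (cart_comp Hl). now apply cart_iso.
Qed.

End BaseChangeTheory.

(** * Dependent products in a change of base *)

Section BaseChangeDepProd.
Variables (A E B : fib_category) (p : functor E B) (F : functor A B).

Notation bc := (base_change p F).

Hypothesis Hp : is_fibred_ttfc p.
Hypothesis HA : is_ttfc A.
Hypothesis HFpb : preserves_fib_pullback F.

Variables (a b c : bc) (f : Hom a b) (g : Hom b c).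
Hypothesis Hg : is_fib g.

Variables (d : bc) (pf : Hom d c).
Variable P1 : dep_prod (bc_fst f) (bc_fst g) (bc_fst pf).
Variables (pa2 : E) (pf2 : Hom pa2 (bc_total c)).
Variable P2 : dep_prod (bc_snd f) (bc_snd g) pf2.

Variable Q : dep_prod (fmap p (bc_snd f)) (fmap p (bc_snd g)) (fmap p pf2).
Hypothesis HQ : forall (x z : E) (h : Hom x (bc_total c)) (q : Hom z (bc_total b))
  (r : Hom z x) (pb : is_pullback q r (bc_snd g) h)
  (Fpb : is_pullback (fmap p q) (fmap p r) (fmap p (bc_snd g)) (fmap p h))
  (k : over h pf2),
  transpose Q Fpb (fmap_over p k) = fmap_over p (transpose P2 pb k).

Variables (z1 : A) (q1 : Hom z1 (bc_base b)) (r1 : Hom z1 (bc_base d)).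
Hypothesis pb1 : is_pullback q1 r1 (bc_fst g) (bc_fst pf).
Hypothesis pbB : is_pullback (bc_inv b ∘ fmap F q1) (fmap F r1)
  (fmap p (bc_snd g)) (bc_inv c ∘ fmap F (bc_fst pf)).

(** The evaluation morphism of the dependent product in [A]. *)
Let ev1 : over q1 (bc_fst f) := transpose P1 pb1 (exist _ (idm (bc_base d)) (comp_idr (bc_fst pf))).

(* [cmp] is the comparison [F (Π_g f) -> Π_(F g) (F f)] in [B]. *)
Variable cmp : over (bc_inv c ∘ fmap F (bc_fst pf)) (fmap p pf2).
Hypothesis Hcmp :
  proj1_sig (transpose Q pbB cmp) = bc_inv a ∘ fmap F (proj1_sig ev1).

(** Apply [Q] to both sides of the first equation: by naturality and [Hcmp] the side with [cmp]
    becomes the image under [F] of the transpose of [k1], by [HQ] the other becomes the image under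
    [p] of that of [k2]. Injectivity of transposition gives the equivalence. *)
Lemma transpose_above (x z : bc) (h : Hom x c) (q : Hom z b) (r : Hom z x)
    (pbA : is_pullback (bc_fst q) (bc_fst r) (bc_fst g) (bc_fst h))
    (pbE : is_pullback (bc_snd q) (bc_snd r) (bc_snd g) (bc_snd h))
    (k1 : over (bc_fst h) (bc_fst pf)) (k2 : over (bc_snd h) pf2) :
  fmap p (proj1_sig k2) = proj1_sig cmp ∘ fmap F (proj1_sig k1) ∘ bc_eq x <->
  fmap p (proj1_sig (transpose P2 pbE k2))
    = bc_inv a ∘ fmap F (proj1_sig (transpose P1 pbA k1)) ∘ bc_eq z.
Proof.
destruct Hg as [_ Hg2].
pose proof (ttf_fib_pullback (fttfc_functor Hp) Hg2 pbE) as pbp.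
destruct (pb_over pb1 pbA k1) as [y1 Hy1].
assert (Hs : (bc_inv c ∘ fmap F (bc_fst pf)) ∘ (fmap F (proj1_sig k1) ∘ bc_eq x)
  = fmap p (bc_snd h)).
{ rw (fmap_eq2 F (proj2_sig k1)). now rewrite bc_sq'. }
assert (Hy : (bc_inv b ∘ fmap F q1) ∘ (fmap F (proj1_sig y1) ∘ bc_eq z)
  = fmap p (bc_snd q)).
{ rw (fmap_eq2 F (proj2_sig y1)). now rewrite bc_sq'. }
pose (s := exist _ _ Hs : over (fmap p (bc_snd h)) (bc_inv c ∘ fmap F (bc_fst pf))).
pose (y := exist _ _ Hy : over (fmap p (bc_snd q)) (bc_inv b ∘ fmap F q1)).
assert (N : transpose Q pbp (over_comp cmp s) = over_comp (transpose Q pbB cmp) y).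
{ apply transpose_nat. simpl. rw (fmap_sq F Hy1). now rw (bc_sq r). }
(* Every transpose is evaluation precomposed with the morphism induced between the pullbacks. *)
assert (T1 : proj1_sig (transpose P1 pbA k1) = proj1_sig ev1 ∘ proj1_sig y1).
{ pose proof (transpose_nat P1 pb1 pbA Hy1 (exist _ (idm (bc_base d)) (comp_idr (bc_fst pf)))) as K.
  apply (f_equal (@proj1_sig _ _)) in K; simpl in K. fold ev1 in K.
  rewrite <- K. do 2 f_equal. apply over_eq; simpl. now rewrite comp_idl. }
assert (N' : proj1_sig (transpose Q pbp (over_comp cmp s))
  = bc_inv a ∘ fmap F (proj1_sig (transpose P1 pbA k1)) ∘ bc_eq z).
{ rewrite N; simpl. rewrite Hcmp, T1, fmap_comp. now asc. }
rewrite <- N'.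
pose proof (f_equal (@proj1_sig _ _) (HQ pbE pbp k2)) as K; simpl in K.
rewrite <- K. clear K N'.
split; intros H.
- do 2 f_equal. apply over_eq; simpl. rewrite H. now asc.
- apply over_eq, transpose_inj in H.
  apply (f_equal (@proj1_sig _ _)) in H; simpl in H. rewrite H. now asc.
Qed.


(** * The dependent product as a cartesian lift along the comparison *)

Variable th : Hom (bc_total d) pa2.
Hypothesis Hth : is_cartesian p th.
Hypothesis Hpth : fmap p th = proj1_sig cmp ∘ bc_eq d.
Hypothesis Hpf : pf2 ∘ th = bc_snd pf.

Definition over_fst (x y : bc) (h : Hom x c) (q : Hom y c) (k : over h q) :
  over (bc_fst h) (bc_fst q) :=
  exist _ (bc_fst (proj1_sig k)) (bc_fst_eq (proj2_sig k)).

Lemma over_th_proof (x : bc) (h : Hom x c) (k : over h pf) :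
  pf2 ∘ (th ∘ bc_snd (proj1_sig k)) = bc_snd h.
Proof. rw Hpf. exact (bc_snd_eq (proj2_sig k)). Qed.

Definition over_th (x : bc) (h : Hom x c) (k : over h pf) : over (bc_snd h) pf2 :=
  exist _ (th ∘ bc_snd (proj1_sig k)) (over_th_proof k).

Section Transpose.
Variables (x z : bc) (h : Hom x c) (q : Hom z b) (r : Hom z x).
Hypothesis pb : is_pullback q r g h.

Definition bc_pb_fst := proj1 (bc_pb_components Hp HA HFpb Hg pb).
Definition bc_pb_snd := proj2 (bc_pb_components Hp HA HFpb Hg pb).

Lemma bc_transpose_above (k : over h pf) :
  bc_eq a ∘ fmap p (proj1_sig (transpose P2 bc_pb_snd (over_th k)))
  = fmap F (proj1_sig (transpose P1 bc_pb_fst (over_fst k))) ∘ bc_eq z.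
Proof.
rewrite (proj1 (transpose_above bc_pb_fst bc_pb_snd (over_fst k) (over_th k))).
- asc. rewrite bc_invK. now rewrite comp_idl.
- simpl. rewrite fmap_comp, Hpth. rw (bc_sq (proj1_sig k)). easy.
Qed.

Lemma bc_transpose_over (k : over h pf) : f ∘ bc_mk (bc_transpose_above k) = q.
Proof.
apply bc_ext.
- exact (proj2_sig (transpose P1 bc_pb_fst (over_fst k))).
- exact (proj2_sig (transpose P2 bc_pb_snd (over_th k))).
Qed.

Definition bc_transpose (k : over h pf) : over q f :=
  exist _ (bc_mk (bc_transpose_above k)) (bc_transpose_over k).

(** Both components of [m] are transposed back. By [transpose_above] the resulting [k2] lies above
    [cmp ∘ F k1], so it factors uniquely through the cartesian [th]. *)
Lemma bc_transpose_bij (m : over q f) : exists! k : over h pf, bc_transpose k = m.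
Proof.
destruct m as [m Hm].
destruct (transpose_surj P1 bc_pb_fst (exist _ (bc_fst m) (bc_fst_eq Hm))) as [k1 Hk1].
destruct (transpose_surj P2 bc_pb_snd (exist _ (bc_snd m) (bc_snd_eq Hm))) as [k2 Hk2].
assert (K : fmap p (proj1_sig k2)
  = proj1_sig cmp ∘ fmap F (proj1_sig k1) ∘ bc_eq x).
{ apply (transpose_above bc_pb_fst bc_pb_snd). rewrite Hk1, Hk2. apply bc_sq'. }
destruct (cart_fill (g := proj1_sig k2)
  (s := bc_inv d ∘ fmap F (proj1_sig k1) ∘ bc_eq x) Hth) as [n [Hn1 Hn2]].
{ rewrite Hpth, K. rw (bc_invK d). now rewrite comp_idr. }
assert (Hn : bc_eq d ∘ fmap p n = fmap F (proj1_sig k1) ∘ bc_eq x).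
{ rewrite Hn2. rw (bc_invK d). now rewrite comp_idl. }
assert (Hk : pf ∘ bc_mk Hn = h).
{ apply bc_ext.
  - exact (proj2_sig k1).
  - rewrite bc_snd_comp, <- Hpf, <- comp_assoc. simpl. rewrite Hn1.
    exact (proj2_sig k2). }
exists (exist (fun l => pf ∘ l = h) (bc_mk Hn) Hk); split.
- apply over_eq, bc_ext; simpl.
  + transitivity (proj1_sig (transpose P1 bc_pb_fst k1)); [|now rewrite Hk1].
    do 2 f_equal. now apply over_eq.
  + transitivity (proj1_sig (transpose P2 bc_pb_snd k2)); [|now rewrite Hk2].
    do 2 f_equal. now apply over_eq.
- intros k Ek.
  apply (f_equal (@proj1_sig _ _)) in Ek; simpl in Ek.
  assert (E1 : over_fst k = k1).
  { apply (transpose_inj (P := P1) (pb := bc_pb_fst)). rewrite Hk1.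
    apply over_eq; simpl. now rewrite <- Ek. }
  assert (E2 : over_th k = k2).
  { apply (transpose_inj (P := P2) (pb := bc_pb_snd)). rewrite Hk2.
    apply over_eq; simpl. now rewrite <- Ek. }
  apply over_eq, bc_ext; simpl.
  + now rewrite <- E1.
  + apply (cart_eq Hth).
    * rewrite Hn1. now rewrite <- E2.
    * rewrite Hn2, <- E1. symmetry. apply bc_sq'.
Qed.

End Transpose.

Lemma bc_transpose_nat (x z : bc) (h : Hom x c) (q : Hom z b) (r : Hom z x)
    (pb : is_pullback q r g h)
    (x' z' : bc) (h' : Hom x' c) (q' : Hom z' b) (r' : Hom z' x')
    (pb' : is_pullback q' r' g h')
    (s : over h' h) (y : over q' q) :
  r ∘ proj1_sig y = proj1_sig s ∘ r' ->
  forall k : over h pf,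
  bc_transpose pb' (over_comp k s) = over_comp (bc_transpose pb k) y.
Proof.
intros Es k. apply over_eq, bc_ext; simpl.
- pose (y1 := exist _ (bc_fst (proj1_sig y)) (bc_fst_eq (proj2_sig y))
    : over (bc_fst q') (bc_fst q)).
  pose proof (transpose_nat P1 (bc_pb_fst pb) (bc_pb_fst pb') (s := over_fst s)
    (y := y1) (bc_fst_eq Es) (over_fst k)) as K.
  apply (f_equal (@proj1_sig _ _)) in K; simpl in K. rewrite <- K.
  do 2 f_equal. now apply over_eq.
- pose (y2 := exist _ (bc_snd (proj1_sig y)) (bc_snd_eq (proj2_sig y))
    : over (bc_snd q') (bc_snd q)).
  pose (s2 := exist _ (bc_snd (proj1_sig s)) (bc_snd_eq (proj2_sig s))
    : over (bc_snd h') (bc_snd h)).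
  pose proof (transpose_nat P2 (bc_pb_snd pb) (bc_pb_snd pb') (s := s2)
    (y := y2) (bc_snd_eq Es) (over_th k)) as K.
  apply (f_equal (@proj1_sig _ _)) in K; simpl in K. rewrite <- K.
  do 2 f_equal. apply over_eq; simpl. apply comp_assoc.
Qed.

Lemma bc_dep_prod : inhabited (dep_prod f g pf).
Proof. exact (inhabits (DepProd bc_transpose_bij bc_transpose_nat)). Qed.

End BaseChangeDepProd.

(** * Universes in a change of base *)

Section BaseChangeUniverse.
Variables (A E B : fib_category) (p : functor E B) (F : functor A B).

Notation bc := (base_change p F).

Hypothesis Hp : is_fibred_ttfc p.
Hypothesis HA : is_ttfc A.
Hypothesis HFpb : preserves_fib_pullback F.
Hypothesis HFacof : preserves_acof F.

Variables (W1 W : E) (w : Hom W1 W).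
Hypothesis Hw : is_fibred_universe p w.

Variables (x1 x0 : bc) (v : Hom x1 x0).
Hypothesis Hv : is_universe (bc_fst v).

Variables (h : Hom (F (bc_base x0)) (p W)) (k : Hom (F (bc_base x1)) (p W1)).
Hypothesis Hpb : is_pullback k (fmap F (bc_fst v)) (fmap p w) h.

Variables (ch : Hom (bc_total x0) W) (ck : Hom (bc_total x1) W1).
Hypothesis Hch : is_cartesian p ch.
Hypothesis Hck : is_cartesian p ck.
Hypothesis Hpch : fmap p ch = h ∘ bc_eq x0.
Hypothesis Hpck : fmap p ck = k ∘ bc_eq x1.
Hypothesis Hsq : ch ∘ bc_snd v = w ∘ ck.

Let Hfib := fttfc_fibred Hp.
Let HE := fttfc_total Hp.
Let UE := funiverse_total Hw.
Let UB := funiverse_base Hw.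

Lemma small_fmap (a b : A) (s : Hom a b) :
  is_small (bc_fst v) s -> is_small (fmap p w) (fmap F s).
Proof.
intros [h0 [k0 P]]. apply (small_pullback (HFpb (universe_fib Hv) P)).
now exists h, k.
Qed.

Lemma bc_eq_pb (a b : bc) (f : Hom a b) :
  is_pullback (bc_eq a) (fmap p (bc_snd f)) (fmap F (bc_fst f)) (bc_eq b).
Proof. apply pb_iso_h; [symmetry; apply bc_sq| |]; apply bc_eq_iso. Qed.

Lemma small_fmap_snd (a b : bc) (f : Hom a b) :
  is_small (bc_fst v) (bc_fst f) -> is_small (fmap p w) (fmap p (bc_snd f)).
Proof. intros H; exact (small_pullback (bc_eq_pb f) (small_fmap H)). Qed.

(** The square from [h^*w] to [w] has cartesian horizontal sides above a pullback, so it is a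
    pullback. *)
Lemma small_snd_v : is_small w (bc_snd v).
Proof.
exists ch, ck. apply cart_pullback with (p := p); [easy|easy|easy|].
rewrite Hpch, Hpck. exact (pb_paste Hpb (bc_eq_pb v)).
Qed.

Lemma fib_v : is_fib v.
Proof.
split; [exact (universe_fib Hv)|exact (small_fib HE (universe_fib UE) small_snd_v)].
Qed.

Lemma bc_small_components (a b : bc) (f : Hom a b) : is_small v f ->
  is_small (bc_fst v) (bc_fst f) /\ is_small w (bc_snd f).
Proof.
intros [h0 [k0 P]]. destruct (bc_pb_components Hp HA HFpb fib_v P) as [P1 P2].
split; [now exists (bc_fst h0), (bc_fst k0)|exact (small_pullback P2 small_snd_v)].
Qed.

(** The lifting axiom for [w] gives a square for [bc_snd f] above [h ∘ F h0]; it factors through the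
    cartesian [ch] and [ck], and cancellation leaves a pullback of [h^*w]. Prescribing [h0] and [k0]
    serves both smallness in [F^*E] and its lifting axiom. *)
Lemma bc_small_lift (a b : bc) (f : Hom a b)
    (h0 : Hom (bc_base b) (bc_base x0)) (k0 : Hom (bc_base a) (bc_base x1)) :
  is_pullback k0 (bc_fst f) (bc_fst v) h0 -> is_small w (bc_snd f) ->
  exists (h' : Hom b x0) (k' : Hom a x1),
  is_pullback k' f v h' /\ bc_fst h' = h0 /\ bc_fst k' = k0.
Proof.
intros P Sf. pose proof (HFpb (universe_fib Hv) P) as PF.
pose proof (pb_paste Hpb (pb_paste PF (bc_eq_pb f))) as PP.
destruct (funiverse_lift Hw Sf PP) as [h1 [k1 [P1 [Hh1 Hk1]]]].
destruct (cart_fill (g := h1) (s := bc_inv x0 ∘ fmap F h0 ∘ bc_eq b) Hch)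
  as [h2 [Eh2 Ph2]].
{ rewrite Hpch, Hh1. rw (bc_invK x0). now rewrite comp_idr. }
destruct (cart_fill (g := k1) (s := bc_inv x1 ∘ fmap F k0 ∘ bc_eq a) Hck)
  as [k2 [Ek2 Pk2]].
{ rewrite Hpck, Hk1. rw (bc_invK x1). now rewrite comp_idr. }
assert (Hh : bc_eq x0 ∘ fmap p h2 = fmap F h0 ∘ bc_eq b).
{ rewrite Ph2. rw (bc_invK x0). now rewrite comp_idl. }
assert (Hk : bc_eq x1 ∘ fmap p k2 = fmap F k0 ∘ bc_eq a).
{ rewrite Pk2. rw (bc_invK x1). now rewrite comp_idl. }
assert (P2 : is_pullback k2 (bc_snd f) (bc_snd v) h2).
{ apply (pb_cancel (k := ck) (q := w) (h := ch)).
  - apply cart_pullback with (p := p); [easy|easy|easy|].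
    rewrite Hpch, Hpck. exact (pb_paste Hpb (bc_eq_pb v)).
  - apply (cart_eq Hch).
    + rw Hsq. rw Ek2. rw Eh2. apply (proj1 P1).
    + rewrite !fmap_comp. apply (iso_mono (bc_eq_iso x0)).
      rw (bc_sq v). rw Hk. rw Hh. rw (bc_sq f). now rw (fmap_sq F (proj1 P)).
  - now rewrite Ek2, Eh2. }
exists (bc_mk Hh), (bc_mk Hk); split; [|easy].
now apply bc_pb_intro.
Qed.

Lemma bc_small_intro (a b : bc) (f : Hom a b) :
  is_small (bc_fst v) (bc_fst f) -> is_small w (bc_snd f) -> is_small v f.
Proof.
intros [h0 [k0 P]] Sf. destruct (bc_small_lift P Sf) as [h' [k' [P' _]]].
now exists h', k'.
Qed.

Lemma bc_small_factor (a b c : bc) (f : Hom a c) (g : Hom b c) (m : Hom a b) :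
  is_small v f -> is_small v g -> g ∘ m = f ->
  exists (n : bc) (i : Hom a n) (q : Hom n b),
  is_acof i /\ is_small v q /\ q ∘ i = m.
Proof.
intros Sf Sg Em.
destruct (bc_small_components Sf) as [Sf1 Sf2], (bc_small_components Sg) as [Sg1 Sg2].
destruct (universe_factor Hv Sf1 Sg1 (bc_fst_eq Em)) as [n1 [i1 [q1 [Hi1 [Sq1 Eq1]]]]].
(* With [F n1] as the middle object in [B], the [y] obtained is an object of [F^*E] above [n1]. *)
destruct (small_factor_above Hp Hw (i := fmap F i1 ∘ bc_eq a)
  (q := bc_inv b ∘ fmap F q1) Sf2 Sg2 (bc_snd_eq Em))
  as [y [e [i2 [q2 [Hi2 [Sq2 [Eq2 [Pi2 Pq2]]]]]]]].
- apply acof_comp; [now apply HFacof|apply iso_acof, bc_eq_iso].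
- apply (universe_comp UB); [apply (small_iso UB), bc_inv_iso|now apply small_fmap].
- rw (fmap_eq2 F Eq1). now rewrite bc_sq'.
- pose (n := BcOb e : bc).
  assert (Hi : bc_eq n ∘ fmap p (i2 : Hom _ (bc_total n)) = fmap F i1 ∘ bc_eq a)
    by exact Pi2.
  assert (Hq : bc_eq b ∘ fmap p (q2 : Hom (bc_total n) _) = fmap F q1 ∘ bc_eq n).
  { transitivity (bc_eq b ∘ (bc_inv b ∘ fmap F q1 ∘ eq_hom e));
      [exact (f_equal (comp (bc_eq b)) Pq2)|].
    rw (bc_invK b). now rewrite comp_idl. }
  exists n, (bc_mk Hi), (bc_mk Hq); split; [|split].
  + now apply bc_acof.
  + now apply bc_small_intro.
  + now apply bc_ext.
Qed.

Lemma bc_small_dep_prod_exists (a b c : bc) (f : Hom a b) (g : Hom b c) :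
  is_small v f -> is_small v g ->
  exists (d : bc) (pf : Hom d c), is_small v pf /\ inhabited (dep_prod f g pf).
Proof.
intros Sf Sg.
destruct (bc_small_components Sf) as [Sf1 Sf2], (bc_small_components Sg) as [Sg1 Sg2].
assert (Fg : is_fib g).
{ split; [exact (small_fib HA (universe_fib Hv) Sg1)
         |exact (small_fib HE (universe_fib UE) Sg2)]. }
assert (Ff1 : is_fib (bc_fst f)) by exact (small_fib HA (universe_fib Hv) Sf1).
assert (Ff2 : is_fib (bc_snd f)) by exact (small_fib HE (universe_fib UE) Sf2).
destruct (ttfc_dep_prod HA Ff1 (proj1 Fg)) as [pa1 [pf1 D1]].
pose proof (universe_dep_prod Hv Sf1 Sg1 D1) as Spf1.
destruct (ttfc_dep_prod HE Ff2 (proj2 Fg)) as [pa2 [pf2 D2]].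
pose proof (universe_dep_prod UE Sf2 Sg2 D2) as Spf2.
destruct D1 as [Fpf1 [P1]], D2 as [Fpf2 [P2]].
destruct (ttf_dep_prod (fttfc_functor Hp) Ff2 (proj2 Fg) Fpf2 P2) as [Q HQ].
destruct (ttfc_pullback HA pf1 (proj1 Fg)) as [z1 [q1 [r1 pb1]]].
pose proof (HFpb (proj1 Fg) pb1) as pbF.
pose proof (pb_conj_cospan pbF) as pbB.
pose (ev1 := transpose P1 pb1 (exist _ (idm pa1) (comp_idr pf1))).
assert (Hev : fmap p (bc_snd f) ∘ (bc_inv a ∘ fmap F (proj1_sig ev1))
  = bc_inv b ∘ fmap F q1).
{ rw (bc_sq_inv f). now rw (fmap_eq2 F (proj2_sig ev1)). }
destruct (transpose_surj Q pbB
  (exist (fun l => fmap p (bc_snd f) ∘ l = bc_inv b ∘ fmap F q1) _ Hev))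
  as [cmp Hcmp].
apply (f_equal (@proj1_sig _ _)) in Hcmp; simpl in Hcmp.
destruct (cart_lift (proj1_sig cmp) Hfib) as [x [th [e [Hth Hpth]]]].
pose (d := BcOb e : bc).
assert (Hpf : bc_eq c ∘ fmap p (pf2 ∘ th : Hom (bc_total d) _) = fmap F pf1 ∘ bc_eq d).
{ rewrite fmap_comp, Hpth. rw (proj2_sig cmp). rewrite bc_invK. now rewrite comp_idl. }
exists d, (bc_mk Hpf); split.
- apply bc_small_intro; [easy|].
  destruct (cart_lift (bc_inv c ∘ fmap F pf1) Hfib) as [y [cy [ey [Hcy Hpcy]]]].
  destruct (cart_fill (g := pf2 ∘ th) (s := eq_hom (eq_sym ey) ∘ eq_hom e) Hcy)
    as [n [Hn1 Hn2]].
  { rewrite Hpcy, fmap_comp, Hpth. rw (proj2_sig cmp). rw (eq_hom_symK ey).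
    now rewrite comp_idr. }
  simpl. rewrite <- Hn1. apply (universe_comp UE).
  + apply (funiverse_cartesian Hw Hcy). rewrite Hpcy.
    apply (universe_comp UB); [apply (universe_comp UB)|].
    * apply (small_iso UB), bc_inv_iso.
    * now apply small_fmap.
    * apply (small_iso UB), eq_hom_iso.
  + apply (vertical_small Hp Hw Spf2 Hth Hcy Hn1).
    rewrite Hn2. apply iso_comp; apply eq_hom_iso.
- refine (bc_dep_prod (d := d) Hp HA HFpb Fg (pf := bc_mk Hpf) (P1 := P1) HQ
    (pb1 := pb1) (pbB := pbB) (cmp := cmp) Hcmp (th := th) Hth Hpth _).
  reflexivity.
Qed.

Lemma bc_universe : is_universe v.
Proof.
constructor.
- exact fib_v.
- intros a b c g f Sg Sf.
  destruct (bc_small_components Sf), (bc_small_components Sg).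
  now apply bc_small_intro; [apply (universe_comp Hv)|apply (universe_comp UE)].
- intros a. apply bc_small_intro; [apply (universe_id Hv)|apply (universe_id UE)].
- intros a b c d f g pf Sf Sg [Fpf [P]].
  destruct (bc_small_dep_prod_exists Sf Sg) as [d' [pf' [Spf' [P']]]].
  assert (Fg : is_fib g).
  { destruct (bc_small_components Sg) as [Sg1 Sg2].
    split; [exact (small_fib HA (universe_fib Hv) Sg1)
           |exact (small_fib HE (universe_fib UE) Sg2)]. }
  destruct (bc_pb_exists Hp HA HFpb pf Fg) as [z [q [r [_ [_ pb]]]]].
  destruct (bc_pb_exists Hp HA HFpb pf' Fg) as [z' [q' [r' [_ [_ pb']]]]].
  destruct (dep_prod_unique P P' pb pb') as [m [Im Em]].
  apply (small_pullback (k := m) (q := pf') (h := idm c)); [|easy].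
  apply pb_iso_h; [now rewrite comp_idl|easy|apply iso_id].
- exact bc_small_factor.
Qed.

Lemma bc_fibred_universe : is_fibred_universe (bc_proj p F) v.
Proof.
constructor.
- exact bc_universe.
- exact Hv.
- intros a b f h0 k0 Sf P. apply (bc_small_lift P). now apply bc_small_components.
- intros a b f Hf Sf. apply bc_small_intro; [exact Sf|].
  apply (funiverse_cartesian Hw); [now apply (bc_cart_snd Hp)|].
  now apply small_fmap_snd.
- intros a c g j s t Sg Ss Es tc l m Hl Hlt Elm Hms.
  destruct (bc_small_components Sg) as [Sg1 Sg2].
  assert (Sm1 : is_small (bc_fst v) (bc_fst m)).
  { pose proof (above_dom Hlt) as e. simpl in e. destruct e.
    apply (above_eq (p := bc_proj p F)) in Hms. simpl in Hms. now rewrite Hms. }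
  apply bc_small_intro; [easy|].
  refine (funiverse_induced Hw (g := bc_snd g) Sg2 (small_fmap_snd Sm1) _
    (bc_cart_snd Hp Hl) (Above p _) (bc_snd_eq Elm) (Above p _)).
  exact (fmap_eq2 p (bc_snd_eq Elm)).
Qed.

End BaseChangeUniverse.

Theorem mainTheorem8
  (E B A : fib_category) (p : functor E B) (F : functor A B)
  (* a fibred universe w : W1 -> W in p above u : U1 -> U *)
  (Hp : is_fibred_ttfc p)
  (W1 W : E) (w : Hom W1 W) (U1 U : B) (u : Hom U1 U)
  (Hw : is_fibred_universe p w) (Hwu : above p w u)
  (* a universe v : V1 -> V in A *)
  (HA : is_ttfc A)
  (V1 V : A) (v : Hom V1 V) (Hv : is_universe v)
  (HFfib : preserves_fib F)
  (HFpb : preserves_fib_pullback F)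
  (HFacof : preserves_acof F)
  (h : Hom (F V) U) (k : Hom (F V1) U1)
  (Hpb : is_pullback k (fmap F v) u h)
  (* the cartesian morphisms h^*W -> W and k^*W1 -> W1 above h and k *)
  (hW : E) (ch : Hom hW W) (Hch : is_cartesian p ch) (ahch : above p ch h)
  (kW1 : E) (ck : Hom kW1 W1) (Hck : is_cartesian p ck) (ahck : above p ck k)
  (* the morphism h^*w above F v induced by w *)
  (hw : Hom kW1 hW) (Hhw : ch ∘ hw = w ∘ ck) (ahw : above p hw (fmap F v)) :
  is_fibred_universe (bc_proj p F)
    (BcHom (x := BcOb (bc_base := V1) (bc_total := kW1) (above_dom ahck))
           (y := BcOb (bc_base := V) (bc_total := hW) (above_dom ahch))
           (bc_fst := v) (bc_snd := hw) ahw).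
Proof.
destruct Hwu.
assert (Hpch : fmap p ch = h ∘ eq_hom (above_dom ahch)).
{ pose proof (proj1 (above_iff ch h (above_dom ahch) eq_refl) ahch) as H.
  simpl in H. now rewrite comp_idl in H. }
assert (Hpck : fmap p ck = k ∘ eq_hom (above_dom ahck)).
{ pose proof (proj1 (above_iff ck k (above_dom ahck) eq_refl) ahck) as H.
  simpl in H. now rewrite comp_idl in H. }
apply (bc_fibred_universe (p := p)) with (w := w) (h := h) (k := k) (ch := ch) (ck := ck);
  assumption.
Qed.
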